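(* Let $d\ge2$ be an integer and let $\{\phi^n_v:v\in T_n\}$ be the branching random walk at time $n$ on the $d$-ary tree. For $u\in T_n$ and $n$ sufficiently large, $$m_n-\frac{3\sqrt2}{\sqrt{\log d}}\log n+O(1)\;\le\;\mathbb{E}\left(\phi^n_u\,\middle|\,\phi^n_v\ge 0\ \ \forall v\in T_n\right)\;\le\; m_n-\frac{\sqrt2}{\sqrt{\log d}}\log n+O(1).$$
   Context: Fix an integer $d\ge 2$. $T^n$ is the rooted $d$-ary tree of height $n$ (each vertex at levels $0,\dots,n-1$ has $d$ children) and $T_n$ is its set of $d^n$ leaves, identified with $\{1,\dots,d^n\}$. For $v\in T_n$ and $1\le i\le n$ put $a_i(v)=\lceil v/d^{\,n-i}\rceil$ (the ancestor of $v$ at level $i$). Let $\{X_{i,j}:1\le i\le n,\ 1\le j\le d^i\}$ be i.i.d. standard Gaussian random variables. The branching random walk (BRW) at time $n$ is $\phi^n_v=\sum_{j=1}^n X_{j,a_j(v)}$, $v\in T_n$. Equivalently, it is the centered Gaussian vector with $\mathrm{Var}(\phi^n_v)=n$ and $\mathrm{Cov}(\phi^n_u,\phi^n_v)=n-\frac12 d_T(u,v)$ for $u\ne v$, where $d_T$ is graph distance in the tree. $m_n=\sqrt{2\log d}\,n-\frac{3}{2\sqrt{2\log d}}\log n$, with $\log$ the natural logarithm. The integer $d$ is fixed, and $O(1)$ denotes a quantity bounded as $n\to\infty$. *)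

(* Defs.v *)
From HB Require Import structures.
From mathcomp Require Import all_boot all_order all_algebra.
From mathcomp Require Import all_classical all_reals all_analysis.
From mathcomp Require Import zify lra.

Set Implicit Arguments.
Unset Strict Implicit.
Unset Printing Implicit Defensive.

Import Order.TTheory GRing.Theory Num.Theory.
Import numFieldNormedType.Exports.

Local Open Scope classical_set_scope.
Local Open Scope ring_scope.

Definition ceil_div (m k : nat) : nat := ((m + k.-1) %/ k)%N.

Lemma ceil_divE (m k : nat) : (0 < k)%N ->
  (ceil_div m k)%:Z = Num.ceil (m%:R / k%:R : rat).
Proof.
move=> k0; apply/esym; rewrite /ceil_div.
have k0r : (0 : rat) < k%:R by rewrite ltr0n.
have h := divn_eq (m + k.-1) k; set q := ((m + k.-1) %/ k)%N in h *.
have hr : ((m + k.-1) %% k < k)%N by rewrite ltn_mod.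
apply: ceil_def; rewrite ltr_pdivlMr // ler_pdivrMr //.
rewrite rmorphB /= rmorph1 -!pmulrn mulrBl mul1r ltrBlDr.
by rewrite -natrM -natrD ltr_nat ler_nat; apply/andP; split; lia.
Qed.

(* Leaves of the d-ary tree of height n are labelled 1, ..., d ^ n. *)
Definition leaves (d n : nat) : set nat := [set v | (1 <= v <= d ^ n)%N].

Definition ancestor (d n i v : nat) : nat := ceil_div v (d ^ (n - i)).

Definition edges (d n : nat) : set (nat * nat) :=
  [set p | (1 <= p.1 <= n)%N /\ (1 <= p.2 <= d ^ p.1)%N].

Section probability.
Context (disp : measure_display) (T : measurableType disp) (R : realType)
  (P : probability T R).

Definition mutually_independent (I : eqType) (D : set I)
    (X : I -> {RV P >-> R}) : Prop :=
  forall (s : seq I) (B : I -> set R),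
    uniq s -> (forall i, i \in s -> D i) ->
    (forall i, i \in s -> measurable (B i)) ->
    P (\bigcap_(i in [set` s]) (X i @^-1` B i)) =
      (\prod_(i <- s) P (X i @^-1` B i))%E.

(* normal_prob is a measure only on the Borel sets, hence the restriction to
   measurable B. *)
Definition standard_gaussian (X : {RV P >-> R}) : Prop :=
  forall B : set R, measurable B -> distribution P X B = normal_prob 0 1 B.

Definition iid_standard_gaussian (I : eqType) (D : set I)
    (X : I -> {RV P >-> R}) : Prop :=
  mutually_independent D X /\ (forall i, D i -> standard_gaussian (X i)).

Definition brw (d n : nat) (X : nat * nat -> {RV P >-> R}) (v : nat) : T -> R :=
  fun w => \sum_(1 <= j < n.+1) X (j, ancestor d n j v) w.

(* E(Y | A) = E(Y 1_A) / P(A), meaningful when P A > 0. *)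
Definition cond_expectation (Y : T -> R) (A : set T) : \bar R :=
  ('E_P[(Y \* \1_A)%R] / P A)%E.

End probability.

Definition mean_max (R : realType) (d n : nat) : R :=
  Num.sqrt (2 * ln d%:R) * n%:R - 3 / (2 * Num.sqrt (2 * ln d%:R)) * ln n%:R.

(* Main.v *)
(** By the symmetry of the tree, the conditional mean of one leaf is that of the average [S] of
    all leaves. Integrating [t S + 1 <= exp (t S - c) + c] over the wall event [A] bounds
    [E(S | A)] above by [(ln E(exp (t S)) - ln P(A)) / t] and, with [- t], below by
    [(ln P(A) - ln E(exp (- t S); A)) / t]. All the quantities involved are iterates of the
    one-dimensional map sending [f] to [(gamma * f) ^ d], [gamma] the standard Gaussian law,
    evaluated at [0].

    For [f] the indicator of the half line the iterate [F_n x] is the probability that all leaves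
    are at least [- x]. Explicit super- and subsolutions of the recursion, built from
    [exp (- b z) K(t, z)] with [b = sqrt (2 ln d)] and [K(t, z)] the heat kernel of the half line,
    give [F_n (m_n + C) >= 1/2] and [1 - F_n (b n + 1) >= c n^(-3/2)]; convexity over the last
    levels turns the second estimate into a polynomially small lower tail. Lifting all vertices
    at level about [log_d n] by Gaussian shifts of optimal cost gives
    [- ln P(A) <= (d - 1) / 2 * x ^ 2 + O(n)] with [x = b n - (7/2) ln n / b], and the lower tail
    applied below level about [2 log_d n] bounds [E(exp (- t S); A)] for [t] of order [n] by
    [exp (- t y - (d - 1) / 2 * y ^ 2 + O(n))] with [y = b n - (37/5) ln n / b]. Taking
    [t = (d - 1) x] above and [t] a large multiple of [n] below yields the two bounds. *)
From HB Require Import structures.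
Require Import Defs.
From mathcomp Require Import all_boot all_order all_algebra.
From mathcomp Require Import all_classical all_reals all_analysis.
From mathcomp Require Import measurable_realfun.
From mathcomp Require Import zify ring lra.
Set Implicit Arguments.
Unset Strict Implicit.
Unset Printing Implicit Defensive.
Import Order.TTheory GRing.Theory Num.Theory.
Import numFieldNormedType.Exports.
Local Open Scope classical_set_scope.
Local Open Scope ring_scope.

(** * Gaussian integrals *)

(** Write [L] for [ln n] and count losses in units of [L / b]. Since sqrt 2 / sqrt (ln d) = 2 / b,
    the two bounds to be reached are [b n - (7/2) L / b] and [b n - (15/2) L / b]. The total tilt
    has order [n], so logarithms of probabilities are needed only up to O(n). For P(A), the lifted
    level needs at least order [n] vertices for the quadratic cost to be optimal up to O(n), and at
    most order [n] for the constant costs per vertex to sum to O(n). Giving up log_d n levels loses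
    2 units, and 3/2 + 2 = 7/2. For the tilted wall, a subtree starts at height of order [n] and
    must feel a bounded total tilt. Its own tilt must then be of order 1/n, which forces [n^2]
    vertices and loses 4 units. The lower tail loses another 17/5: it takes 8/5 log_d n levels, a
    little over 3/2, to overcome the probability n^(-3/2), hence 16/5, and the rest is slack. So
    37/5 appears where 15/2 is allowed. The remaining 1/10 pays for the mismatch between the
    exponents at 7/2 and 37/5, which a large tilt makes small. *)

Section gauss_density.
Context {R : realType}.
Notation mu := (@lebesgue_measure R).

Import HBNNSimple.

(** Monotone approximation by simple functions reduces this to level sets, where it is the
    definition of [normal_prob]. *)
Lemma integral_normal_prob (m s : R) (f : R -> \bar R) :
  measurable_fun setT f -> (forall x, 0 <= f x)%E ->
  (\int[normal_prob m s]_x f x = \int[mu]_x (f x * (normal_pdf m s x)%:E))%E.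
Proof.
move=> mf f0.
have mpdf : measurable_fun setT (fun x : R => (normal_pdf m s x)%:E).
  by apply/measurable_EFinP; exact: measurable_normal_pdf.
have pdf0 x : (0 <= (normal_pdf m s x)%:E)%E by rewrite lee_fin normal_pdf_ge0.
pose f_ := nnsfun_approx measurableT mf.
have nd_ x k n : (k <= n)%N -> ((f_ k x)%:E <= (f_ n x)%:E)%E.
  by move=> kn; rewrite lee_fin; move: kn => /(nd_nnsfun_approx measurableT mf)/lefP/(_ x).
have mf_ n : measurable_fun [set: R] (fun x : R => (f_ n x)%:E).
  by apply/measurable_EFinP.
transitivity (limn (fun n => \int[normal_prob m s]_x (f_ n x)%:E)%E).
  rewrite -monotone_convergence//.
  - by apply: eq_integral => x _; apply/esym/cvg_lim => //; exact: cvg_nnsfun_approx.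
  - by move=> *; rewrite lee_fin.
  - by move=> x _ k n kn; exact: nd_.
transitivity (limn (fun n => \int[mu]_x ((f_ n x)%:E * (normal_pdf m s x)%:E))%E); last first.
  rewrite -monotone_convergence//.
  - apply: eq_integral => x _; apply/cvg_lim => //.
    by apply: cvgeZr => //; exact: cvg_nnsfun_approx.
  - by move=> n; apply: emeasurable_funM; [exact: mf_|exact: mpdf].
  - by move=> *; rewrite mule_ge0// lee_fin.
  - move=> x _ k n kn; rewrite lee_wpmul2r//; exact: nd_.
have mi r n : measurable_fun [set: R] (fun x : R => (r * \1_(f_ n @^-1` [set r]) x)%:E).
  by apply/measurable_EFinP/measurableT_comp => //; exact: measurable_indic.
have i0 r n x : (0 <= (r * \1_(f_ n @^-1` [set r]) x)%:E)%E.
  by rewrite EFinM nnfun_muleindic_ge0.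
congr (limn _); apply/funext => n.
under eq_integral do rewrite fimfunE -fsumEFin//.
rewrite ge0_integral_fsum//; [|by move=> r; exact: mi|by move=> r x _; exact: i0].
under [RHS]eq_integral.
  move=> x _; rewrite fimfunE -fsumEFin// ge0_mule_fsuml; last by move=> r; exact: i0.
  over.
rewrite /= ge0_integral_fsum//; first last.
  - by move=> r x _; rewrite mule_ge0//; exact: i0.
  - by move=> r; apply: emeasurable_funM; [exact: mi|exact: mpdf].
apply: eq_fsbigr => r /set_mem [y _ <-].
have mA : measurable (f_ n @^-1` [set f_ n y]) by [].
have mI : measurable_fun [set: R] (fun x : R => (\1_(f_ n @^-1` [set f_ n y]) x : R)%:E).
  by apply/measurable_EFinP; exact: measurable_indic.
have fy0 : (0 <= (f_ n y)%:E :> \bar R)%E by rewrite lee_fin.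
transitivity ((f_ n y)%:E * \int[normal_prob m s]_x (\1_(f_ n @^-1` [set f_ n y]) x)%:E)%E.
  rewrite -ge0_integralZl//.
rewrite integral_indic//= setIT.
under [RHS]eq_integral do rewrite EFinM -muleA.
rewrite ge0_integralZl//=; first last.
- by move=> x _; rewrite mule_ge0// lee_fin.
- by apply: emeasurable_funM; [exact: mI|exact: mpdf].
congr (_ * _)%E; rewrite /normal_prob.
rewrite [LHS]integral_mkcond; apply: eq_integral => x _.
by rewrite patchE indicE /=; case: ifPn => _; rewrite ?mul1e ?mul0e.
Qed.

End gauss_density.

Section gauss_mean.
Context {R : realType}.
Notation mu := (@lebesgue_measure R).
Implicit Types f g : R -> R.

Definition gauss : probability (measurableTypeR R) R := normal_prob 0 1.

(** Real-valued, so that linear arithmetic applies; an infinite integral would get the default value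
    0, whence the side conditions [gint] below. *)
Definition gmean (f : R -> R) : R := (\int[gauss]_s f s)%R.
Definition gint (f : R -> R) := gauss.-integrable setT (EFin \o f).

Lemma gint_le f g : measurable_fun setT f -> (forall s, `|f s| <= g s) ->
  gint g -> gint f.
Proof.
move=> mf fg gg; apply: (le_integrable _ _ _ gg) => //.
  exact/measurable_EFinP.
move=> s _ /=; rewrite lee_fin (le_trans (fg s))// ler_norm//.
Qed.

Lemma gint_cst (c : R) : gint (fun=> c).
Proof. exact: finite_measure_integrable_cst. Qed.

Lemma gint_bounded f (M : R) : measurable_fun setT f -> (forall s, `|f s| <= M) ->
  gint f.
Proof. by move=> mf fM; apply: gint_le (gint_cst M). Qed.

Lemma gintD f g : gint f -> gint g -> gint (fun s => f s + g s).
Proof. by move=> hf hg; exact: (integrableD measurableT hf hg). Qed.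

Lemma gintB f g : gint f -> gint g -> gint (fun s => f s - g s).
Proof. by move=> hf hg; exact: (integrableB measurableT hf hg). Qed.

Lemma gintZ (c : R) f : gint f -> gint (fun s => c * f s).
Proof. by move=> hf; exact: (integrableZl measurableT c hf). Qed.

Lemma gmean_cst (c : R) : gmean (fun=> c) = c.
Proof.
by rewrite /gmean /Rintegral integral_cst//= probability_setT mule1.
Qed.

Lemma gmeanD f g : gint f -> gint g -> gmean (fun s => f s + g s) = gmean f + gmean g.
Proof. by move=> ? ?; exact: RintegralD. Qed.

Lemma gmeanB f g : gint f -> gint g -> gmean (fun s => f s - g s) = gmean f - gmean g.
Proof. by move=> ? ?; exact: RintegralB. Qed.

Lemma gmeanZ (c : R) f : gint f -> gmean (fun s => c * f s) = c * gmean f.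
Proof. by move=> ?; exact: RintegralZl. Qed.

Lemma gmean_le f g : gint f -> gint g -> (forall s, f s <= g s) -> gmean f <= gmean g.
Proof. by move=> ? ? fg; apply: le_Rintegral => // s _. Qed.

Lemma gmean_ge0 f : (forall s, 0 <= f s) -> 0 <= gmean f.
Proof. by move=> f0; apply: Rintegral_ge0 => s _. Qed.

Lemma eq_gmean f g : f =1 g -> gmean f = gmean g.
Proof. by move=> fg; apply: eq_Rintegral => s _; rewrite fg. Qed.

Lemma gmeanE f : gint f -> (\int[gauss]_s (f s)%:E = (gmean f)%:E)%E.
Proof. by move=> gf; rewrite /gmean /Rintegral fineK//; exact: integrable_fin_num. Qed.

Lemma ge0_gint f (r : R) : measurable_fun setT f -> (forall s, 0 <= f s) ->
  (\int[gauss]_s (f s)%:E = r%:E)%E -> gint f /\ gmean f = r.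
Proof.
move=> mf f0 fr; split; last by rewrite /gmean /Rintegral fr.
apply/integrableP; split; first exact/measurable_EFinP.
under eq_integral do rewrite /= ger0_norm//.
by rewrite fr ltry.
Qed.

(** Reflection preserves the length of intervals, and these determine Lebesgue measure. *)
Lemma lebesgue_integral_reflection (m : R) (f : R -> \bar R) :
  measurable_fun setT f -> (forall x, 0 <= f x)%E ->
  (\int[mu]_x f (m - x)%R = \int[mu]_x f x)%E.
Proof.
move=> mf f0.
have mr : measurable_fun [set: measurableTypeR R] (fun x : R => m - x : measurableTypeR R).
  exact: measurable_funB.
pose mphi := isMeasurableFun.Build _ _ _ _ _ mr.
pose phi : {mfun measurableTypeR R >-> measurableTypeR R} := HB.pack (fun x : R => m - x) mphi.
have muN A : measurable A -> pushforward mu phi A = mu A.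
  move=> mA; apply/esym/lebesgue_measure_unique => //= _ [[a b]] _ <-.
  rewrite /pushforward /=.
  rewrite (_ : _ @^-1` _ = `[m - b, m - a[%classic); last first.
    by apply/seteqP; split => x /=; rewrite !in_itv/=; lra.
  rewrite !lebesgue_measure_itv/= !lte_fin.
  have -> : (m - b < m - a) = (a < b) by apply/idP/idP; lra.
  by case: ifP => // _; rewrite -EFinD -[RHS]EFinD; congr EFin; lra.
transitivity (\int[pushforward mu phi]_x f x)%E.
  by rewrite ge0_integral_pushforward.
by apply: eq_measure_integral => A mA _; exact: muN.
Qed.

Definition gpeak : R := normal_peak 1.

Lemma gpeak_gt0 : 0 < gpeak.
Proof. exact: normal_peak_gt0. Qed.

Lemma normal_pdf01E (s : R) : normal_pdf 0 1 s = gpeak * expR (- (s ^+ 2 / 2)).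
Proof.
by rewrite normal_pdfE//= /normal_fun subr0 expr1n mulNr.
Qed.

(* Completing the square: up to the factor [sg] this exponential is the density of
   N(m, sg^2) relative to N(0, 1). *)
Definition gtilt (m sg s : R) : R := expR (s ^+ 2 / 2 - (s - m) ^+ 2 / (2 * sg ^+ 2)).

Lemma gtilt_gt0 m sg s : 0 < gtilt m sg s.
Proof. exact: expR_gt0. Qed.

Lemma gtilt_pdf (m sg s : R) : 0 < sg ->
  gtilt m sg s * normal_pdf 0 1 s = sg * normal_pdf m sg s.
Proof.
move=> sg0; rewrite normal_pdf01E normal_pdfE ?gt_eqF//=.
rewrite mulrCA -expRD /normal_fun.
rewrite [RHS]mulrA; congr (_ * expR _); last first.
  by field; rewrite gt_eqF.
rewrite /gpeak /normal_peak expr1n mul1r -mulrnAr sqrtrM ?sqr_ge0//.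
by rewrite sqrtr_sqr gtr0_norm// invfM mulrA divff ?mul1r ?gt_eqF.
Qed.

Lemma measurable_gtilt m sg : measurable_fun [set: R] (gtilt m sg).
Proof.
apply: continuous_measurable_fun => x; rewrite /gtilt.
apply: (cvg_comp _ expR); last exact: continuous_expR.
apply: cvgB; apply: cvgMl.
  by apply: exprn_continuous.
apply: (@cvg_comp _ _ _ (fun s => s - m) (fun s => s ^+ 2)); last exact: exprn_continuous.
by apply: cvgB; [exact: cvg_id|exact: cvg_cst].
Qed.

Lemma gtiltP (m sg : R) : 0 < sg ->
  gint (gtilt m sg) /\ gmean (gtilt m sg) = sg.
Proof.
move=> sg0; apply: ge0_gint; first exact: measurable_gtilt.
  by move=> s; exact/ltW/gtilt_gt0.
rewrite integral_normal_prob//; first last.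
  by move=> s; rewrite lee_fin ltW// gtilt_gt0.
  by apply/measurable_EFinP; exact: measurable_gtilt.
under eq_integral do rewrite -EFinM gtilt_pdf// EFinM.
rewrite ge0_integralZl//=.
- by rewrite integral_normal_pdf mule1.
- by apply/measurable_EFinP; exact: measurable_normal_pdf.
- by move=> s _; rewrite lee_fin normal_pdf_ge0.
- by rewrite lee_fin ltW.
Qed.

(** The linear factor is dominated by [expR (s - m) + expR (- (s - m))], and each exponential merely
    moves the centre of the Gaussian weight by [sg ^+ 2]. *)
Lemma gint_tilt1 (m sg : R) : 0 < sg -> gint (fun s => (s - m) * gtilt m sg s).
Proof.
move=> sg0.
have shift e : e ^+ 2 = 1 -> forall s,
    expR (e * (s - m)) * gtilt m sg s = expR (sg ^+ 2 / 2) * gtilt (m + e * sg ^+ 2) sg s.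
  move=> e1 s; rewrite /gtilt -!expRD; congr expR.
  have -> : (s - (m + e * sg ^+ 2)) ^+ 2 =
      (s - m) ^+ 2 - 2 * e * (s - m) * sg ^+ 2 + e ^+ 2 * sg ^+ 4 by ring.
  rewrite e1.
  by field; rewrite gt_eqF.
apply: (@gint_le _ (fun s => expR (sg ^+ 2 / 2) * gtilt (m + 1 * sg ^+ 2) sg s +
                    expR (sg ^+ 2 / 2) * gtilt (m + -1 * sg ^+ 2) sg s)).
- apply: measurable_funM; last exact: measurable_gtilt.
  exact: measurable_funB.
- move=> s; rewrite -!shift ?sqrrN ?expr1n// -mulrDl normrM.
  rewrite (gtr0_norm (gtilt_gt0 _ _ _)) ler_pM2r ?gtilt_gt0//.
  rewrite mul1r mulN1r.
  have := expR_ge1Dx (s - m); have := expR_ge1Dx (- (s - m)).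
  have := expR_gt0 (s - m); have := expR_gt0 (- (s - m)).
  case: (lerP 0 (s - m)) => h; [rewrite ger0_norm//|rewrite ltr0_norm//]; lra.
- by apply: gintD; apply: gintZ; apply: (gtiltP _ sg0).1.
Qed.

(** Reflection in [m] exchanges the positive and the negative part. *)
Lemma gmean_tilt1 (m sg : R) : 0 < sg -> gmean (fun s => (s - m) * gtilt m sg s) = 0.
Proof.
move=> sg0; have gi := gint_tilt1 m sg0.
pose f s := (s - m) * gtilt m sg s.
pose fp s := Num.max (s - m) 0 * gtilt m sg s.
pose fn s := Num.max (m - s) 0 * gtilt m sg s.
have mp : measurable_fun setT fp.
  apply: measurable_funM; last exact: measurable_gtilt.
  by apply: measurable_maxr => //; exact: measurable_funB.
have mn : measurable_fun setT fn.
  apply: measurable_funM; last exact: measurable_gtilt.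
  by apply: measurable_maxr => //; exact: measurable_funB.
have fpn s : f s = fp s - fn s.
  rewrite /f /fp /fn -mulrBl; congr (_ * _).
  by rewrite !maxEge; case: ifP; case: ifP; lra.
have t0 s := gtilt_gt0 m sg s.
have gp : gint fp.
  apply: (gint_le mp _ (integrable_norm gi)) => s /=.
  rewrite !normrM ler_wpM2r// ?normr_ge0//.
  rewrite maxEge; case: ifP => h; rewrite ?normr0 ?normr_ge0//.
have gn : gint fn.
  apply: (gint_le mn _ (integrable_norm gi)) => s /=.
  rewrite !normrM ler_wpM2r// ?normr_ge0//.
  by rewrite maxEge; case: ifP => h; rewrite ?normr0 ?normr_ge0// distrC.
rewrite (eq_gmean fpn) gmeanB//; apply/eqP; rewrite subr_eq0; apply/eqP.
have p0 s : 0 <= fp s by rewrite mulr_ge0 ?(ltW (t0 s))// le_max lexx orbT.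
have n0 s : 0 <= fn s by rewrite mulr_ge0 ?(ltW (t0 s))// le_max lexx orbT.
apply: EFin_inj; rewrite -!gmeanE//.
rewrite !integral_normal_prob//; try exact/measurable_EFinP; try by move=> s; rewrite lee_fin.
rewrite -[LHS](lebesgue_integral_reflection (2 * m)); first last.
- by move=> s; rewrite -EFinM lee_fin mulr_ge0// normal_pdf_ge0.
- apply: emeasurable_funM; first exact/measurable_EFinP.
  by apply/measurable_EFinP; exact: measurable_normal_pdf.
apply: eq_integral => s _; rewrite -!EFinM; congr EFin.
rewrite /fp /fn -!mulrA !gtilt_pdf//; congr (Num.max _ _ * (_ * _)); first lra.
rewrite !normal_pdfE ?gt_eqF//=; congr (_ * expR _); congr (- _ * _); ring.
Qed.

Lemma gint_exp (l : R) : gint (fun s => expR (l * s)).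
Proof.
have [gi _] := @gtiltP l 1 ltr01.
have -> : (fun s => expR (l * s)) = (fun s => expR (l ^+ 2 / 2) * gtilt l 1 s).
  apply/funext => s; rewrite /gtilt -expRD; congr expR; by field.
exact: gintZ.
Qed.

Lemma gmean_exp (l : R) : gmean (fun s => expR (l * s)) = expR (l ^+ 2 / 2).
Proof.
have [gi gm] := @gtiltP l 1 ltr01.
transitivity (gmean (fun s => expR (l ^+ 2 / 2) * gtilt l 1 s)); last first.
  by rewrite gmeanZ// gm mulr1.
apply: eq_gmean => s.
rewrite /gtilt -expRD; congr expR; by field.
Qed.

(** On [[a, b]] the density is at least its value at distance [M] from 0. All explicit lower bounds
    on Gaussian probabilities come from here. *)
Lemma gmean_indic_ge (a b M c : R) (f : R -> R) : a <= b -> `|a| <= M -> `|b| <= M -> 0 <= c ->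
  gint f -> (forall s, 0 <= f s) -> (forall s, a <= s <= b -> c <= f s) ->
  c * ((b - a) * (gpeak * expR (- (M ^+ 2 / 2)))) <= gmean f.
Proof.
move=> ab aM bM c0 gf f0 fc.
rewrite -lee_fin -gmeanE// integral_normal_prob; first last.
- by move=> s; rewrite lee_fin.
- by have /integrableP[] := gf.
set k := gpeak * _.
have k0 : 0 <= k by rewrite mulr_ge0 ?(ltW gpeak_gt0) ?expR_ge0.
apply: (@le_trans _ _ (\int[mu]_(s in `[a, b]) (c * k)%:E)%E).
  rewrite integral_cst//= lebesgue_measure_itv/= lte_fin; case: ltP => h.
    by rewrite -EFinD -EFinM lee_fin mulrA (mulrC c) -mulrA mulrC mulrA.
  by rewrite mule0 lee_fin (_ : b - a = 0) ?mul0r ?mulr0//; lra.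
have mf : measurable_fun setT (fun s : R => (f s)%:E * (normal_pdf 0 1 s)%:E)%E.
  apply: emeasurable_funM; first by have /integrableP[] := gf.
  by apply/measurable_EFinP; exact: measurable_normal_pdf.
apply: (@le_trans _ _ (\int[mu]_(s in `[a, b]) ((f s)%:E * (normal_pdf 0 1 s)%:E))%E).
  apply: ge0_le_integral => //.
  - by move=> s _; rewrite lee_fin mulr_ge0.
  - exact: measurable_funTS.
  - move=> s /=; rewrite in_itv/= => sab; rewrite -EFinM lee_fin ler_pM ?fc//.
    rewrite normal_pdf01E ler_pM2l ?gpeak_gt0// ler_expR lerN2 ler_pM2r//.
    rewrite -[leLHS]real_normK ?num_real// ler_sqr ?nnegrE//; last exact: le_trans aM.
    by move: aM bM sab; rewrite !ler_norml; lra.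
apply: ge0_subset_integral => //.
by move=> s _; rewrite -EFinM lee_fin mulr_ge0// normal_pdf_ge0.
Qed.

End gauss_mean.

(** * Integrating out one independent Gaussian variable *)

Section integrate_out.
Context (disp : measure_display) (T : measurableType disp) (R : realType)
  (P : probability T R).
Context (I : eqType) (D : set I) (X : I -> {RV P >-> R}).
Hypothesis indep : mutually_independent D X.
Variables (s : seq I) (e : I).
Hypothesis us : uniq s.
Hypothesis sD : forall i, i \in s -> D i.
Hypothesis De : D e.
Hypothesis es : e \notin s.
Hypothesis ge : standard_gaussian (X e).

Definition cylinders : set (set T) :=
  [set A | exists2 B : I -> set R, (forall i, measurable (B i)) &
     A = \bigcap_(i in [set` s]) (X i @^-1` B i)].

Lemma cylinders_measurable : cylinders `<=` measurable.
Proof.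
move=> _ [B mB ->]; apply: fin_bigcap_measurable => //.
by move=> i _; rewrite -[X in measurable X]setTI; exact: measurable_funP.
Qed.

Lemma cylindersT : cylinders setT.
Proof.
exists (fun=> setT) => //.
by apply/seteqP; split => // w _ i _.
Qed.

Lemma cylinders_setI : setI_closed cylinders.
Proof.
move=> _ _ [B mB ->] [B' mB' ->]; exists (fun i => B i `&` B' i).
  by move=> i; exact: measurableI.
by rewrite -bigcapI; apply: eq_bigcapr => i _; rewrite preimage_setI.
Qed.

(** Both sides are finite measures in [E]; independence makes them agree on the cylinders, which are
    stable under intersection. *)
Lemma indep_cylinders (C : set R) (E : set T) : measurable C ->
  <<s cylinders >> E -> P (E `&` X e @^-1` C) = (P E * gauss C)%E.
Proof.
move=> mC sE.
have mXC : measurable (X e @^-1` C).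
  by rewrite -[X in measurable X]setTI; exact: measurable_funP.
have gC : P (X e @^-1` C) = gauss C by rewrite -[RHS]ge.
have fC : gauss C \is a fin_num by rewrite -gC fin_num_measure.
pose r : {nonneg R} := NngNum (fine_ge0 (measure_ge0 (gauss : {measure set _ -> \bar R}) C)).
have rE : (r%:num)%:E = gauss C by rewrite -[RHS]fineK.
transitivity (mrestr P mXC E) => //.
rewrite (@g_sigma_algebra_measure_unique _ _ _ cylinders cylinders_measurable
  (fun=> setT) (fun=> cylindersT) _ (mrestr P mXC) (mscale r P)) //.
- by rewrite muleC -rE.
- by rewrite bigcup_const.
- exact: cylinders_setI.
- move=> _ [B mB ->]; transitivity (gauss C * P (\bigcap_(i in [set` s]) X i @^-1` B i))%E;
    last by rewrite -rE.
  rewrite /= /mrestr.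
  pose B' i := if i == e then C else B i.
  have sB i : i \in s -> B' i = B i.
    by move=> si; rewrite /B'; case: eqP => // ie; move: es; rewrite -ie si.
  have mB' i : measurable (B' i) by rewrite /B'; case: ifP.
  have -> : (\bigcap_(i in [set` s]) X i @^-1` B i) `&` X e @^-1` C =
      \bigcap_(i in [set` e :: s]) X i @^-1` B' i.
    apply/seteqP; split => [w [ws we] i|w ws]/=.
      by rewrite inE => /predU1P[->|si]; [rewrite /B' eqxx|rewrite sB//; exact: ws].
    split; last by have := ws e; rewrite /= /B' eqxx inE eqxx; apply.
    by move=> i /= si; have := ws i; rewrite /= sB// inE si orbT; apply.
  have := indep (s := e :: s) (B := B'); rewrite /= es us big_cons.
  move=> /(_ isT) -> //; first last.
  + by move=> i; rewrite inE => /predU1P[->//|/sD].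
  + rewrite [in RHS](indep (s := s) (B := B))//.
    by rewrite /B' eqxx gC; congr (_ * _)%E; apply: eq_big_seq => i si; rewrite -/(B' i) sB.
- move=> k; apply: (@le_lt_trans _ _ (P (setT `&` X e @^-1` C))) => //.
  rewrite (le_lt_trans (probability_le1 _ _)) ?ltry//; exact: measurableI.
Qed.

(** The sample space with the coarser sigma-algebra generated by the [X i], [i \in s]. Measurability
    on [restT] expresses that a function depends on these variables only. *)
Definition restT := g_sigma_algebraType cylinders.

Lemma measurable_id_restT : measurable_fun [set: T] (id : T -> restT).
Proof.
move=> _ Y mY; rewrite setTI preimage_id.
exact: (smallest_sub (@sigma_algebra_measurable _ T) cylinders_measurable).
Qed.

Lemma measurable_RV_restT i : i \in s -> measurable_fun [set: restT] (X i : restT -> R).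
Proof.
move=> si _ Y mY; rewrite setTI; apply: sub_sigma_algebra.
exists (fun j => if j == i then Y else setT); first by move=> j; case: ifP.
apply/seteqP; split => [w Yw j _|w /(_ i)/=]; last by rewrite eqxx; exact.
by case: eqP => [->|].
Qed.

Let pid : {RV P >-> restT} := HB.pack (id : T -> restT)
  (isMeasurableFun.Build _ _ _ _ _ measurable_id_restT).

Lemma measurable_joint : measurable_fun [set: T]
  (fun w => (w, X e w) : restT * measurableTypeR R).
Proof.
apply/measurable_fun_pairP; split; first exact: measurable_id_restT.
exact: (@measurable_funPT _ _ _ _ (X e)).
Qed.

Let joint : {RV P >-> (restT * measurableTypeR R)%type} := HB.pack
  (fun w => (w, X e w) : restT * measurableTypeR R)
  (isMeasurableFun.Build _ _ _ _ _ measurable_joint).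

(** By independence the law of [(w, X e w)] on [restT * R] is a product measure, so Tonelli
    applies. *)
Lemma integrate_out (F : restT * measurableTypeR R -> \bar R) :
  measurable_fun setT F -> (forall x, 0 <= F x)%E ->
  (\int[P]_w F (w, X e w) = \int[P]_w \int[gauss]_t F (w, t))%E.
Proof.
move=> mF F0.
have -> : (\int[P]_w F (w, X e w) = \int[distribution P joint]_z F z)%E.
  by rewrite ge0_integral_distribution.
have -> : (\int[distribution P joint]_z F z =
           \int[(distribution P pid \x gauss)%E]_z F z)%E.
  apply: eq_measure_integral => A mA _.
  apply/esym/product_measure_unique => // B C mB mC.
  by rewrite -indep_cylinders.
rewrite fubini_tonelli1// ge0_integral_distribution//.
  exact: measurable_fun_fubini_tonelli_F.
by move=> w; exact: integral_ge0.
Qed.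

End integrate_out.

(** * The law of the branching random walk *)

Lemma measurable_prode (d : measure_display) (T : measurableType d) (R : realType)
    (I : eqType) (r : seq I) (F : I -> T -> \bar R) :
  (forall i, i \in r -> measurable_fun setT (F i)) ->
  measurable_fun setT (fun x => \prod_(i <- r) F i x)%E.
Proof.
elim: r => [|i r IH] mF.
  by under eq_fun do rewrite big_nil; exact: measurable_cst.
under eq_fun do rewrite big_cons.
apply: emeasurable_funM; first by apply: mF; rewrite inE eqxx.
by apply: IH => j jr; apply: mF; rewrite inE jr orbT.
Qed.

Lemma measurable_sumr (d : measure_display) (T : measurableType d) (R : realType)
    (I : eqType) (r : seq I) (F : I -> T -> R) :
  (forall i, i \in r -> measurable_fun setT (F i)) ->
  measurable_fun setT (fun x => \sum_(i <- r) F i x).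
Proof.
elim: r => [|i r IH] mF.
  by under eq_fun do rewrite big_nil; exact: measurable_cst.
under eq_fun do rewrite big_cons.
apply: measurable_funD; first by apply: mF; rewrite inE eqxx.
by apply: IH => j jr; apply: mF; rewrite inE jr orbT.
Qed.

Section shift_mean.
Context {R : realType}.

Definition shift_mean (f : R -> \bar R) (x : R) : \bar R :=
  (\int[gauss]_s f (x + s)%R)%E.

Lemma shift_mean_ge0 f x : (forall y, 0 <= f y)%E -> (0 <= shift_mean f x)%E.
Proof. by move=> f0; apply: integral_ge0. Qed.

Lemma measurable_shift_mean f : measurable_fun setT f -> (forall y, 0 <= f y)%E ->
  measurable_fun setT (shift_mean f).
Proof.
move=> mf f0.
pose F (z : R * measurableTypeR R) := f (z.1 + z.2).
have mF : measurable_fun setT F.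
  apply: measurableT_comp => //.
  by apply: measurable_funD; [exact: measurable_fst|exact: measurable_snd].
exact: (@measurable_fun_fubini_tonelli_F _ _ _ _ _ gauss F mF (fun _ => f0 _)).
Qed.

(** Labels start at 0 here: the children of [p] are [p * d + c], [c < d]. Each round merges the
    functions attached to siblings into one function of the position of their parent. *)
Fixpoint tree_val (d m : nat) (f : nat -> R -> \bar R) : \bar R :=
  if m is m'.+1 then
    tree_val d m' (fun p x => \prod_(c < d) shift_mean (f (p * d + c)%N) x)%E
  else f 0%N 0.

End shift_mean.

Section tree_law.
Context (disp : measure_display) (T : measurableType disp) (R : realType)
  (P : probability T R).
Variables (d n : nat) (X : nat * nat -> {RV P >-> R}).
Hypothesis d0 : (0 < d)%N.
Hypothesis iid : iid_standard_gaussian (edges d n) X.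

(** The walk with leaves labelled from 0: the ancestor at level [j] is then a plain quotient, and
    the successor returns to the labels of the edges, which start at 1. *)
Definition path_sum (m a : nat) (w : T) : R :=
  \sum_(1 <= j < m.+1) X (j, (a %/ d ^ (m - j)).+1) w.

Lemma path_sumS m a w : path_sum m.+1 a w = path_sum m (a %/ d) w + X (m.+1, a.+1) w.
Proof.
rewrite /path_sum big_nat_recr//= subnn divn1; congr (_ + _).
apply: eq_big_nat => j /andP[j1 jm].
by rewrite subSn// expnS divnMA.
Qed.

Definition edge_seq : seq (nat * nat) :=
  [seq (j, a) | j <- iota 1 n, a <- iota 1 (d ^ j)].

Lemma edge_seqP j a : ((j, a) \in edge_seq) = [&& 1 <= j <= n & 1 <= a <= d ^ j]%N.
Proof.
apply/allpairsPdep/idP => [[i [b [+ + [-> ->]]]]|].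
  by rewrite !mem_iota; lia.
by move=> /andP[jn ad]; exists j, a; rewrite !mem_iota; split => //; lia.
Qed.

Lemma uniq_edge_seq : uniq edge_seq.
Proof.
apply: allpairs_uniq_dep; [exact: iota_uniq|by move=> j _; exact: iota_uniq|].
by move=> [i a] [j b] _ _ /= [-> ->].
Qed.

Definition other_edges e := [seq i <- edge_seq | i != e].

Lemma measurable_edge e i : i \in other_edges e ->
  measurable_fun [set: restT X (other_edges e)] (X i : restT X (other_edges e) -> R).
Proof. exact: measurable_RV_restT. Qed.

Lemma measurable_path_sum e m a : (m <= n)%N -> (a < d ^ m)%N ->
  (forall j, (1 <= j <= m)%N -> (j, (a %/ d ^ (m - j)).+1) != e) ->
  measurable_fun [set: restT X (other_edges e)] (path_sum m a : restT X (other_edges e) -> R).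
Proof.
move=> mn am ne; apply: measurable_sumr => j; rewrite mem_index_iota => jm.
have aj : (a %/ d ^ (m - j) < d ^ j)%N.
  by rewrite ltn_divLR ?expn_gt0 ?d0// -expnD addnC subnK//; lia.
apply: measurable_edge; rewrite mem_filter edge_seqP ne//=.
by apply/andP; split; [lia|exact: aj].
Qed.

(* Integrating out the edges of the last level one at a time. *)
Lemma integrate_last_level m (f : nat -> R -> \bar R) : (m < n)%N ->
  (forall a, measurable_fun setT (f a)) -> (forall a x, 0 <= f a x)%E ->
  (\int[P]_w \prod_(a < d ^ m.+1) f a (path_sum m.+1 a w) =
   \int[P]_w \prod_(a < d ^ m.+1) shift_mean (f a) (path_sum m (a %/ d) w))%E.
Proof.
move=> mn mf f0.
pose g k a w := if (a < k)%N then shift_mean (f a) (path_sum m (a %/ d) w)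
                else f a (path_sum m.+1 a w).
suff H k : (k <= d ^ m.+1)%N ->
    (\int[P]_w \prod_(a < d ^ m.+1) f a (path_sum m.+1 a w) =
     \int[P]_w \prod_(a < d ^ m.+1) g k a w)%E.
  rewrite (H _ (leqnn _)); apply: eq_integral => w _; apply: eq_bigr => a _.
  by rewrite /g ltn_ord.
elim: k => [_|k IH kd].
  by apply: eq_integral => w _; apply: eq_bigr => a _; rewrite /g ltn0.
rewrite IH; last lia.
pose e := (m.+1, k.+1); pose ko := Ordinal kd.
have eD : edges d n e by rewrite /edges /=; lia.
pose s := other_edges e.
have es : e \notin s by rewrite mem_filter eqxx.
have us : uniq s by rewrite filter_uniq// uniq_edge_seq.
have sD i : i \in s -> edges d n i.
  by case: i => j a; rewrite mem_filter edge_seqP /edges /= => /andP[_]; lia.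
pose h w := (\prod_(a < d ^ m.+1 | a != ko) g k a w)%E.
have h0 w : (0 <= h w)%E.
  apply: prode_ge0 => a _; rewrite /g; case: ifP => // _; exact: shift_mean_ge0.
have mpm a : (a < d ^ m.+1)%N -> measurable_fun [set: restT X s] (path_sum m (a %/ d)).
  move=> ad; apply: measurable_path_sum; first lia.
    by rewrite ltn_divLR// -expnSr.
  by move=> j jm; rewrite /e xpair_eqE; lia.
have mh : measurable_fun [set: restT X s] h.
  rewrite /h; under eq_fun do rewrite -big_filter.
  apply: measurable_prode => a; rewrite mem_filter => /andP[ak _].
  have [alk|alk] := boolP (a < k)%N; rewrite /g ?alk ?(negbTE alk).
    apply: measurableT_comp; first exact: measurable_shift_mean.
    exact: mpm.
  apply: measurableT_comp => //; apply: measurable_path_sum => // j jm.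
  rewrite /e xpair_eqE; apply/negP => /andP[/eqP jE]; rewrite jE subnn divn1 eqSS.
  by move: ak; rewrite -val_eqE /= => /negbTE ->.
pose F (z : (restT X s * measurableTypeR R)%type) :=
  (f k (path_sum m (k %/ d)%N z.1 + z.2)%R * h z.1)%E.
have mF : measurable_fun setT F.
  apply: emeasurable_funM.
    apply: measurableT_comp => //; apply: measurable_funD; last exact: measurable_snd.
    by apply: measurableT_comp; [exact: mpm|exact: measurable_fst].
  by apply: measurableT_comp => //; exact: measurable_fst.
have F0 z : (0 <= F z)%E by rewrite mule_ge0.
transitivity (\int[P]_w F (w, X e w))%E.
  apply: eq_integral => w _; rewrite (bigD1 ko)//= /g ltnn /F /=; congr (_ * _)%E.
  by rewrite path_sumS.
rewrite (@integrate_out _ _ _ _ _ _ _ iid.1 s e us sD eD es (iid.2 _ eD) F)//.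
apply: eq_integral => w _; rewrite (bigD1 ko)//=.
rewrite /F /= ge0_integralZr//; first last.
- apply: measurableT_comp => //; exact: measurable_funD.
congr (_ * _)%E; first by rewrite {1}/g ltnS leqnn.
apply: eq_bigr => a; rewrite -val_eqE /= => ak.
by rewrite /g (ltnS a k) (leq_eqVlt a k) (negbTE ak).
Qed.

(** Once the last level is integrated out, siblings share their argument; grouping the factors by
    parent gives the same expression one level up. *)
Lemma expectation_leaves m (f : nat -> R -> \bar R) : (m <= n)%N ->
  (forall a, measurable_fun setT (f a)) -> (forall a x, 0 <= f a x)%E ->
  (\int[P]_w \prod_(a < d ^ m) f a (path_sum m a w) = tree_val d m f)%E.
Proof.
elim: m f => [|m IH] f mn mf f0.
  rewrite expn0 /=; under eq_integral do rewrite big_ord1 /path_sum big_geq//.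
  by rewrite integral_cst// [X in (_ * X)%E](@probability_setT _ _ _ P) mule1.
rewrite integrate_last_level//=.
rewrite -IH; [|lia|move=> p|move=> p x]; last 2 first.
- apply: (@measurable_prode _ _ _ _ _ (fun (c : 'I_d) x => shift_mean (f (p * d + c)%N) x)) => c _.
  exact: measurable_shift_mean.
- by apply: prode_ge0 => c _; exact: shift_mean_ge0.
apply: eq_integral => w _.
rewrite -(big_mkord xpredT (fun a => shift_mean (f a) (path_sum m (a %/ d) w))).
rewrite expnSr big_nat_mul big_mkord; apply: eq_bigr => p _.
rewrite -{1}[(p * d)%N]add0n big_addn big_mkord mulSn addnK; apply: eq_bigr => c _.
by rewrite addnC divnMDl// divn_small// addn0.
Qed.

End tree_law.

(** * Conditioning on the wall *)

Section tree_fun.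
Context {R : realType}.
Variable d : nat.

Definition tree_step (f : R -> \bar R) (x : R) : \bar R :=
  (\prod_(c < d) shift_mean f x)%E.

Definition tree_fun (m : nat) (f : R -> \bar R) : R -> \bar R := iter m tree_step f.

Lemma tree_val_cst m f : tree_val d m (fun=> f) = tree_fun m f 0.
Proof. by elim: m f => [//|m IH] f /=; rewrite IH /tree_fun -iterSr. Qed.

Lemma prode_except (n : nat) (c0 : 'I_n) (x : \bar R) (y : \bar R) :
  (\prod_(c < n) (if c == c0 then x else y) = x * \prod_(c < n.-1) y)%E.
Proof.
rewrite (bigD1 c0)//= eqxx; congr (_ * _)%E.
under eq_bigr => c /negbTE -> do [].
by rewrite !big_const cardC1 !card_ord.
Qed.

Definition leaf_except (u : nat) (f' f : R -> \bar R) (a : nat) : R -> \bar R :=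
  if a == u then f' else f.

(** This is the symmetry of the tree. One round of the recursion preserves the shape with a single
    exceptional vertex, which moves to the parent. *)
Lemma tree_val_except m u f' f : (0 < d)%N -> (u < d ^ m)%N ->
  tree_val d m (leaf_except u f' f) = tree_val d m (leaf_except 0 f' f).
Proof.
move=> d0; elim: m u f' f => [|m IH] u f' f.
  by rewrite expn0 ltnS leqn0 => /eqP ->.
move=> um /=.
pose g' x := (shift_mean f' x * \prod_(c < d.-1) shift_mean f x)%E.
have H v : (v < d ^ m.+1)%N ->
    (fun p x => \prod_(c < d) shift_mean (leaf_except v f' f (p * d + c)) x)%E =
    leaf_except (v %/ d) g' (tree_step f).
  move=> vm; apply/funext => p; apply/funext => x; rewrite {2}/leaf_except.
  have vE := divn_eq v d.
  case: eqP => [->|pv].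
    rewrite /g' -(prode_except (Ordinal (ltn_pmod v d0))).
    apply: eq_bigr => c _; rewrite /leaf_except {2}vE eqn_add2l -val_eqE /=.
    by case: ifP.
  apply: eq_bigr => c _; rewrite /leaf_except; case: eqP => // cE.
  by case: pv; rewrite -cE divnMDl// divn_small// addn0.
rewrite !H ?expn_gt0 ?d0// div0n.
by apply: IH; rewrite ltn_divLR// -expnSr.
Qed.

End tree_fun.

Lemma ge0_integral_lin (disp : measure_display) (T : measurableType disp) (R : realType)
    (mu : {measure set T -> \bar R}) (f g : T -> R) (a b : R) :
  measurable_fun setT f -> measurable_fun setT g ->
  (forall w, 0 <= f w) -> (forall w, 0 <= g w) -> 0 <= a -> 0 <= b ->
  (\int[mu]_w (a * f w + b * g w)%:E =
   a%:E * (\int[mu]_w (f w)%:E) + b%:E * (\int[mu]_w (g w)%:E))%E.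
Proof.
move=> mf mg f0 g0 a0 b0.
rewrite -!ge0_integralZl//; try by [exact/measurable_EFinP|move=> w _; rewrite lee_fin].
rewrite -ge0_integralD//; try by move=> w _; rewrite -EFinM lee_fin mulr_ge0.
- by apply: measurable_funeM; exact/measurable_EFinP.
- by apply: measurable_funeM; exact/measurable_EFinP.
Qed.

Section conditioning.
Context (disp : measure_display) (T : measurableType disp) (R : realType)
  (P : probability T R).
Variables (d n : nat) (X : nat * nat -> {RV P >-> R}).
Hypothesis d0 : (0 < d)%N.
Hypothesis iid : iid_standard_gaussian (edges d n) X.

Lemma brw_path_sum v w : brw d n X v.+1 w = path_sum d X n v w.
Proof.
apply: eq_bigr => j _; congr (X (_, _) w).
rewrite /ancestor /ceil_div addSnnS prednK ?expn_gt0 ?d0//.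
by rewrite divnDr// divnn expn_gt0 d0 addn1.
Qed.

Definition wall_event : set T :=
  [set w | forall v, leaves d n v -> (0 <= brw d n X v w)%R].

Definition wall (x : R) : \bar R := ((0 <= x)%R%:R)%:E.
Definition wall_tilt (t x : R) : \bar R := ((0 <= x)%R%:R * expR (t * x))%:E.

Lemma wall_eventP w : wall_event w <-> forall a : 'I_(d ^ n), 0 <= path_sum d X n a w.
Proof.
split => [Aw a|Aw v].
  by rewrite -brw_path_sum; apply: Aw; rewrite /leaves /=; have := ltn_ord a; lia.
case: v => [|v]; rewrite /leaves/= => vn; first lia.
by rewrite brw_path_sum; exact: (Aw (Ordinal vn)).
Qed.

Lemma measurable_ge0_nat : measurable_fun [set: R] (fun x : R => (0 <= x)%R%:R : R).
Proof.
rewrite (_ : (fun x => _) = \1_`[0, +oo[%classic); last first.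
  apply/funext => x; rewrite indicE; congr (_%:R)%R; congr nat_of_bool.
  by apply/idP/idP; rewrite inE/= in_itv/= andbT.
exact: measurable_indic.
Qed.

Lemma measurable_wall : measurable_fun [set: R] wall.
Proof. by apply/measurable_EFinP; exact: measurable_ge0_nat. Qed.

Lemma measurable_expRM (t : R) : measurable_fun [set: R] (fun x => expR (t * x)).
Proof. by apply: measurableT_comp => //; exact: measurable_funM. Qed.

Lemma measurable_wall_tilt t : measurable_fun [set: R] (wall_tilt t).
Proof.
apply/measurable_EFinP; apply: measurable_funM; first exact: measurable_ge0_nat.
exact: measurable_expRM.
Qed.

Lemma wall_ge0 x : (0 <= wall x)%E. Proof. by rewrite lee_fin. Qed.

Lemma wall_tilt_ge0 t x : (0 <= wall_tilt t x)%E.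
Proof. by rewrite lee_fin mulr_ge0 ?expR_ge0. Qed.

(* The product of these over all leaves is the value at the leaf [u] on the event and
   vanishes off it. *)
Definition leaf_value (u : nat) : nat -> R -> \bar R :=
  leaf_except u (fun x => (Num.max x 0)%:E) wall.

Lemma measurable_leaf_value u a : measurable_fun [set: R] (leaf_value u a).
Proof.
rewrite /leaf_value /leaf_except; case: ifP => _; last exact: measurable_wall.
by apply/measurable_EFinP; exact: measurable_maxr.
Qed.

Lemma leaf_value_ge0 u a x : (0 <= leaf_value u a x)%E.
Proof.
rewrite /leaf_value /leaf_except; case: ifP => _; last exact: wall_ge0.
by rewrite lee_fin le_max lexx orbT.
Qed.

Lemma prod_wall w :
  (\prod_(a < d ^ n) wall (path_sum d X n a w) = (\1_wall_event w)%:E)%E.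
Proof.
have [Aw|nAw] := pselect (wall_event w).
  rewrite indicE mem_set//= big1// => a _.
  by rewrite /wall (iffLR (wall_eventP _) Aw).
rewrite indicE memNset//=; move/wall_eventP: nAw => /existsNP[a na].
by rewrite (bigD1 a)//= {1}/wall (negbTE (introN idP na)) mul0e.
Qed.

Lemma prod_wall_tilt t w :
  (\prod_(a < d ^ n) wall_tilt t (path_sum d X n a w) =
   (\1_wall_event w * expR (t * \sum_(a < d ^ n) path_sum d X n a w))%:E)%E.
Proof.
under eq_bigr do rewrite /wall_tilt EFinM.
rewrite big_split /= prod_wall prodEFin -EFinM mulr_sumr.
by rewrite (big_morph expR (@expRD R) (@expR0 R)).
Qed.

Lemma prod_leaf_value (u : 'I_(d ^ n)) w :
  (\prod_(a < d ^ n) leaf_value u a (path_sum d X n a w) =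
   (path_sum d X n u w * \1_wall_event w)%:E)%E.
Proof.
have [Aw|nAw] := pselect (wall_event w).
  rewrite indicE mem_set//= mulr1 (bigD1 u)//= {1}/leaf_value/leaf_except eqxx.
  have /wall_eventP A := Aw.
  rewrite big1 ?mule1 ?(max_idPl (A u))// => a au.
  by rewrite /leaf_value /leaf_except val_eqE (negbTE au) /wall A.
rewrite indicE memNset//= mulr0; move/wall_eventP: nAw => /existsNP[a na].
rewrite (bigD1 a)//= {1}/leaf_value /leaf_except.
have a0 : path_sum d X n a w <= 0 by rewrite leNgt; apply/negP => /ltW.
by case: ifP => _; rewrite ?(max_idPr a0) ?mul0e// /wall (negbTE (introN idP na)) mul0e.
Qed.

Lemma measurable_wall_event : measurable wall_event.
Proof.
rewrite (_ : wall_event = \bigcap_(v in leaves d n) (brw d n X v @^-1` `[0, +oo[%classic)).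
  apply: fin_bigcap_measurable.
    by apply: (@sub_finite_set _ _ `I_(d ^ n).+1) => // v /andP[_]; rewrite /= ltnS.
  move=> v vn; rewrite -[X in measurable X]setTI.
  suff mb : measurable_fun setT (brw d n X v) by exact: mb.
  by apply: measurable_sumr => j _; exact: measurable_funPT.
by apply/seteqP; split => w Aw v vn; have := Aw v vn; rewrite /= in_itv/= andbT.
Qed.

Lemma prob_wall_event : P wall_event = tree_fun d n wall 0.
Proof.
rewrite -tree_val_cst -(expectation_leaves d0 iid (leqnn n)).
- transitivity (\int[P]_w (\1_wall_event w)%:E)%E.
    by rewrite integral_indic ?setIT//; exact: measurable_wall_event.
  by apply: eq_integral => w _; rewrite prod_wall.
- by move=> _; exact: measurable_wall.
- by move=> _; exact: wall_ge0.
Qed.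

(** The integral of one leaf over the wall event, written through the recursion alone; it depends
    neither on the leaf nor on the probability space. *)
Definition wall_mean : \bar R := tree_val d n (leaf_value 0).

Lemma wall_meanE (u : 'I_(d ^ n)) :
  (\int[P]_w (path_sum d X n u w * \1_wall_event w)%:E = wall_mean)%E.
Proof.
rewrite /wall_mean -(@tree_val_except _ _ n u)//.
rewrite -(expectation_leaves d0 iid (leqnn n)).
- by apply: eq_integral => w _; rewrite prod_leaf_value.
- exact: measurable_leaf_value.
- exact: leaf_value_ge0.
Qed.

Lemma wall_tiltE t :
  (\int[P]_w (\1_wall_event w * expR (t * \sum_(a < d ^ n) path_sum d X n a w))%:E =
   tree_fun d n (wall_tilt t) 0)%E.
Proof.
rewrite -tree_val_cst -(expectation_leaves d0 iid (leqnn n)).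
- by apply: eq_integral => w _; rewrite prod_wall_tilt.
- by move=> _; exact: measurable_wall_tilt.
- by move=> _; exact: wall_tilt_ge0.
Qed.

Lemma measurable_path_sumT m a : measurable_fun setT (path_sum d X m a).
Proof. by apply: measurable_sumr => j _; exact: measurable_funPT. Qed.

Lemma measurable_value (u : 'I_(d ^ n)) :
  measurable_fun setT (fun w => (path_sum d X n u w * \1_wall_event w)%:E).
Proof.
apply/measurable_EFinP; apply: measurable_funM; first exact: measurable_path_sumT.
by apply: measurable_indic; exact: measurable_wall_event.
Qed.

Lemma value_ge0 (u : 'I_(d ^ n)) w : 0 <= path_sum d X n u w * \1_wall_event w.
Proof.
have [Aw|nAw] := pselect (wall_event w).
  by rewrite mulr_ge0// (iffLR (wall_eventP _) Aw).
by rewrite indicE memNset// mulr0.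
Qed.

Lemma wall_mean_avg :
  (\int[P]_w (\sum_(a < d ^ n) path_sum d X n a w * \1_wall_event w)%:E =
   (d ^ n)%:R%:E * wall_mean)%E.
Proof.
under eq_integral do rewrite -sumEFin.
rewrite ge0_integral_sum//; first last.
- by move=> a w _; rewrite lee_fin value_ge0.
- exact: measurable_value.
under eq_bigr do rewrite wall_meanE.
by rewrite sumr_const card_ord mule_natl.
Qed.

Lemma wall_mean_ge0 : (0 <= wall_mean)%E.
Proof.
have u : 'I_(d ^ n) by exists 0%N; rewrite expn_gt0 d0.
by rewrite -(wall_meanE u); apply: integral_ge0 => w _; rewrite lee_fin value_ge0.
Qed.

Let S w := \sum_(a < d ^ n) path_sum d X n a w.

Let S_ge0 w : 0 <= S w * \1_wall_event w.
Proof. by rewrite /S mulr_suml sumr_ge0// => a _; exact: value_ge0. Qed.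

Let mS : measurable_fun setT S.
Proof. by apply: measurable_sumr => a _; exact: measurable_path_sumT. Qed.

Let m1 : measurable_fun setT (\1_wall_event : T -> R).
Proof. by apply: measurable_indic; exact: measurable_wall_event. Qed.

Let mtilt t : measurable_fun setT (fun w => \1_wall_event w * expR (t * S w)).
Proof.
apply: measurable_funM => //; apply: measurableT_comp => //.
exact: measurable_funM.
Qed.

Let tilt_ge0 t w : 0 <= \1_wall_event w * expR (t * S w).
Proof. by rewrite mulr_ge0 ?expR_ge0. Qed.

Let int_wall : (\int[P]_w (\1_wall_event w)%:E = tree_fun d n wall 0)%E.
Proof.
rewrite -prob_wall_event integral_indic ?setIT//; exact: measurable_wall_event.
Qed.

Let int_S : (\int[P]_w (S w * \1_wall_event w)%:E = (d ^ n)%:R%:E * wall_mean)%E.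
Proof. by rewrite -wall_mean_avg; apply: eq_integral => w _; rewrite /S mulr_suml. Qed.

Let mlin (f g : T -> R) a b : measurable_fun setT f -> measurable_fun setT g ->
  measurable_fun setT (fun w => (a * f w + b * g w)%:E).
Proof.
move=> mf mg; apply/measurable_EFinP.
by apply: measurable_funD; apply: measurable_funM.
Qed.

(* Integrate [t S + 1 <= exp (t S - c) + c] over the event. *)
Lemma wall_mean_ub (t c : R) : 0 <= t -> 0 <= c ->
  ((t * (d ^ n)%:R)%:E * wall_mean + tree_fun d n wall 0 <=
   (expR (- c))%:E * tree_fun d n (wall_tilt t) 0 + c%:E * tree_fun d n wall 0)%E.
Proof.
move=> t0 c0; rewrite EFinM -muleA -int_S -wall_tiltE -int_wall.
rewrite -[X in (_ + X <= _)%E]mul1e.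
have mS1 : measurable_fun setT (fun w => S w * \1_wall_event w) by exact: measurable_funM.
rewrite -!ge0_integral_lin ?expR_ge0//.
apply: ge0_le_integral => //; try exact: mlin.
- by move=> w _; rewrite lee_fin addr_ge0// mulr_ge0.
- move=> w _; rewrite lee_fin indicE; case: (_ \in _); rewrite ?mulr0 ?mul0r ?mulr0 ?addr0//.
  rewrite !mulr1 mul1r -expRD; have := expR_ge1Dx (- c + t * S w); lra.
Qed.

(** Integrate [1 + (c - t S) <= expR (c - t S)] over the event. *)
Lemma wall_mean_lb (t c : R) : 0 <= t -> 0 <= c ->
  (tree_fun d n wall 0 + c%:E * tree_fun d n wall 0 <=
   (expR c)%:E * tree_fun d n (wall_tilt (- t)) 0 + (t * (d ^ n)%:R)%:E * wall_mean)%E.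
Proof.
move=> t0 c0; rewrite [(t * _)%:E]EFinM -muleA -int_S -wall_tiltE -int_wall.
rewrite -[X in (X + _ <= _)%E]mul1e.
have mS1 : measurable_fun setT (fun w => S w * \1_wall_event w) by exact: measurable_funM.
rewrite -!ge0_integral_lin ?expR_ge0//.
apply: ge0_le_integral => //; try exact: mlin.
- by move=> w _; rewrite lee_fin addr_ge0// mulr_ge0.
- move=> w _; rewrite lee_fin indicE; case: (_ \in _); rewrite ?mulr0 ?mul0r ?mulr0 ?addr0//.
  rewrite !mulr1 mul1r -expRD; have := expR_ge1Dx (c + - t * S w); lra.
Qed.

Lemma cond_expectation_wall u : leaves d n u ->
  cond_expectation P (brw d n X u) wall_event = (wall_mean / tree_fun d n wall 0)%E.
Proof.
case: u => [|u]; rewrite /leaves /= => un; first lia.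
rewrite /cond_expectation prob_wall_event; congr (_ / _)%E.
rewrite unlock -(wall_meanE (Ordinal un)).
by apply: eq_integral => w _; rewrite /= brw_path_sum.
Qed.

End conditioning.

Arguments wall {R} x.
Arguments wall_tilt {R} t x.

Lemma lee_prode (R : realType) (I : Type) (r : seq I) (f g : I -> \bar R) :
  (forall i, 0 <= f i)%E -> (forall i, f i <= g i)%E ->
  (\prod_(i <- r) f i <= \prod_(i <- r) g i)%E.
Proof.
move=> f0 fg; elim: r => [|i r IH]; first by rewrite !big_nil.
by rewrite !big_cons lee_pmul// prode_ge0.
Qed.

(** * Monotonicity and explicit solutions of the one-dimensional recursion *)

Section tree_fun_theory.
Context {R : realType}.
Variable d : nat.

Lemma tree_step_ge0 (f : R -> \bar R) x : (forall y, 0 <= f y)%E -> (0 <= tree_step d f x)%E.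
Proof. by move=> f0; apply: prode_ge0 => c _; exact: shift_mean_ge0. Qed.

Lemma measurable_tree_step (f : R -> \bar R) : measurable_fun setT f ->
  (forall y, 0 <= f y)%E -> measurable_fun setT (tree_step d f).
Proof.
move=> mf f0.
by apply: measurable_prode => c _; exact: measurable_shift_mean.
Qed.

Lemma tree_funS m (f : R -> \bar R) : tree_fun d m.+1 f = tree_step d (tree_fun d m f).
Proof. by []. Qed.

Lemma tree_fun_add m k (f : R -> \bar R) : tree_fun d (m + k) f = tree_fun d m (tree_fun d k f).
Proof. by rewrite /tree_fun iterD. Qed.

Lemma tree_fun_measurable_ge0 m (f : R -> \bar R) : measurable_fun setT f ->
  (forall y, 0 <= f y)%E ->
  measurable_fun setT (tree_fun d m f) /\ forall y, (0 <= tree_fun d m f y)%E.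
Proof.
move=> mf f0; elim: m => [//|m [mt t0]]; rewrite tree_funS; split.
  exact: measurable_tree_step.
by move=> y; exact: tree_step_ge0.
Qed.

Lemma tree_fun_le m (f g : R -> \bar R) : measurable_fun setT f -> measurable_fun setT g ->
  (forall y, 0 <= f y)%E -> (forall y, f y <= g y)%E ->
  forall y, (tree_fun d m f y <= tree_fun d m g y)%E.
Proof.
move=> mf mg f0 fg.
have g0 y : (0 <= g y)%E by rewrite (le_trans (f0 y)).
elim: m => [//|m IH] y; rewrite !tree_funS /tree_step.
have [mt t0] := tree_fun_measurable_ge0 m mf f0.
have [mt' t0'] := tree_fun_measurable_ge0 m mg g0.
have ms x : measurable_fun [set: measurableTypeR R] (fun s : R => (x + s)%R).
  exact: measurable_funD.
apply: lee_prode => c; first exact: shift_mean_ge0.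
apply: ge0_le_integral => //.
- by apply: measurableT_comp => //; exact: ms.
- by apply: measurableT_comp => //; exact: ms.
Qed.

Lemma measurable_shift (f : R -> R) (x : R) : measurable_fun setT f ->
  measurable_fun setT (fun s : R => f (x + s)).
Proof. by move=> mf; apply: measurableT_comp => //; exact: measurable_funD. Qed.

Lemma tree_step_EFin (f : R -> R) x : gint (fun s => f (x + s)) ->
  tree_step d (EFin \o f) x = ((gmean (fun s => f (x + s))) ^+ d)%:E.
Proof.
move=> gf; rewrite /tree_step /shift_mean gmeanE// prodEFin.
by rewrite prodr_const card_ord.
Qed.

(** Exponentials are reproduced by Gaussian averaging and by powers. The quadratic term is half the
    variance of [u] times the sum of the leaves: an edge at level [j] is counted [d^(m-j)] times. *)
Lemma tree_fun_exp m (a u x : R) : (1 < d)%N ->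
  tree_fun d m (fun y => (expR (a + u * y))%:E) x =
  (expR (a * d%:R ^+ m + u ^+ 2 * d%:R ^+ m * (d%:R ^+ m - 1) / (2 * (d%:R - 1))
         + u * d%:R ^+ m * x))%:E.
Proof.
move=> d1; elim: m x => [|m IH] x.
  by rewrite /= !expr0 subrr !mulr0 mul0r addr0 !mulr1.
have dn1 : d%:R - 1 != 0 :> R by rewrite subr_eq0 pnatr_eq1; lia.
rewrite tree_funS (_ : tree_fun d m _ = EFin \o (fun y =>
  expR (a * d%:R ^+ m + u ^+ 2 * d%:R ^+ m * (d%:R ^+ m - 1) / (2 * (d%:R - 1))
         + u * d%:R ^+ m * y))); last by apply/funext => y; rewrite IH.
set A := a * _ + _ / _; set v := u * d%:R ^+ m.
have E s : expR (A + v * (x + s)) = expR (A + v * x) * expR (v * s).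
  by rewrite -expRD; congr expR; ring.
rewrite tree_step_EFin; last first.
  by rewrite (funext E); apply: gintZ; exact: gint_exp.
rewrite (eq_gmean E) gmeanZ ?gmean_exp//; last exact: gint_exp.
rewrite -expRD -expRM_natl; congr (expR _)%:E.
rewrite /A /v; move: (d%:R : R) dn1 => D dn1; rewrite (exprS D m).
by field.
Qed.

Fixpoint Fr (m : nat) (x : R) : R :=
  if m is m'.+1 then (gmean (fun s => Fr m' (x + s))) ^+ d else (0 <= x)%R%:R.

Lemma FrP m : [/\ tree_fun d m wall = EFin \o Fr m, measurable_fun setT (Fr m) &
  forall x, 0 <= Fr m x <= 1].
Proof.
elim: m => [|m [tE mF F01]]; first split => //.
- exact: measurable_ge0_nat.
- by move=> x /=; case: (0 <= x); rewrite ?lexx ?ler01.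
have gF x : gint (fun s => Fr m (x + s)).
  apply: (@gint_bounded _ _ 1); first exact: measurable_shift.
  by move=> s; rewrite ger0_norm; case/andP: (F01 (x + s)).
have tS : tree_fun d m.+1 wall = EFin \o Fr m.+1.
  by apply/funext => x; rewrite tree_funS tE tree_step_EFin.
split => //.
  apply/measurable_EFinP; rewrite -tS.
  by apply: (tree_fun_measurable_ge0 _ _ _).1; [exact: measurable_wall|exact: wall_ge0].
move=> x /=; rewrite exprn_ge0 ?exprn_ile1//.
- by apply: gmean_ge0 => s; case/andP: (F01 (x + s)).
- rewrite -[leRHS](gmean_cst 1); apply: gmean_le => //; first exact: gint_cst.
  by move=> s; case/andP: (F01 (x + s)).
- by apply: gmean_ge0 => s; case/andP: (F01 (x + s)).
Qed.

Lemma tree_fun_wall m x : tree_fun d m wall x = (Fr m x)%:E.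
Proof. by have [-> _ _] := FrP m. Qed.

Lemma measurable_Fr m : measurable_fun setT (Fr m).
Proof. by have [] := FrP m. Qed.

Lemma Fr_ge0 m x : 0 <= Fr m x. Proof. by have [_ _ /(_ x)/andP[]] := FrP m. Qed.

Lemma Fr_le1 m x : Fr m x <= 1. Proof. by have [_ _ /(_ x)/andP[]] := FrP m. Qed.

Lemma gint_Fr m x : gint (fun s => Fr m (x + s)).
Proof.
apply: (@gint_bounded _ _ 1); first exact: measurable_shift (measurable_Fr m).
by move=> s; rewrite ger0_norm ?Fr_ge0 ?Fr_le1.
Qed.

Lemma gmean_Fr_ge0 m x : 0 <= gmean (fun s => Fr m (x + s)).
Proof. by apply: gmean_ge0 => s; exact: Fr_ge0. Qed.

Lemma gmean_Fr_le1 m x : gmean (fun s => Fr m (x + s)) <= 1.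
Proof.
rewrite -[leRHS](@gmean_cst R 1); apply: gmean_le; [exact: gint_Fr|exact: gint_cst|].
by move=> s; exact: Fr_le1.
Qed.

Lemma Fr_homo m : {homo Fr m : x y / x <= y}.
Proof.
elim: m => [|m IH] x y xy /=.
  rewrite ler_nat; case: (lerP 0 x) => // x0; case: (lerP 0 y) => //; lra.
rewrite lerXn2r ?nnegrE ?gmean_Fr_ge0//.
by apply: gmean_le; [exact: gint_Fr|exact: gint_Fr|move=> s; apply: IH; lra].
Qed.

End tree_fun_theory.

(** * The upper bound for the maximum *)

Lemma one_le_expR (R : realType) (x : R) : 0 <= x -> 1 <= expR x.
Proof. by move=> x0; have := expR_ge1Dx x; lra. Qed.

Section heat.
Context {R : realType}.
Variable b : R.
Hypothesis b0 : 0 < b.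

(** Up to a constant, minus the space derivative of the heat kernel. Being odd in [z], it solves the
    heat equation on the half line with zero boundary value, although the averages run over the
    whole line. *)
Definition heat (t z : R) : R := z * expR (- (z ^+ 2 / (2 * t))) / (t * Num.sqrt t).

(** Completing the square writes the integrand as an affine function of [s] times [gtilt m sg s],
    and the part linear in [s - m] has mean 0. *)
Lemma heat_tilt (t x : R) : 0 < t ->
  gint (fun s => expR (- b * (x + s)) * heat t (x + s)) /\
  gmean (fun s => expR (- b * (x + s)) * heat t (x + s)) =
    expR (- b * x + b ^+ 2 / 2) * heat (t + 1) (x - b).
Proof.
move=> t0; have t1 : 0 < t + 1 by lra.
pose sg := Num.sqrt t / Num.sqrt (t + 1).
have st0 : 0 < Num.sqrt t by rewrite sqrtr_gt0.
have st1 : 0 < Num.sqrt (t + 1) by rewrite sqrtr_gt0.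
have sg0 : 0 < sg by rewrite divr_gt0.
have sg2 : sg ^+ 2 = t / (t + 1) by rewrite expr_div_n !sqr_sqrtr// ltW.
pose m := - (b * t + x) / (t + 1).
pose c := expR (- b * x + b ^+ 2 / 2 - (x - b) ^+ 2 / (2 * (t + 1))) / (t * Num.sqrt t).
have E s : expR (- b * (x + s)) * heat t (x + s) =
    c * ((s - m) * gtilt m sg s) + c * (x + m) * gtilt m sg s.
  rewrite /heat /c /gtilt sg2.
  have he : expR (- b * (x + s)) * expR (- ((x + s) ^+ 2 / (2 * t))) =
      expR (- b * x + b ^+ 2 / 2 - (x - b) ^+ 2 / (2 * (t + 1))) *
      expR (s ^+ 2 / 2 - (s - m) ^+ 2 / (2 * (t / (t + 1)))).
    by rewrite -!expRD; congr expR; rewrite /m; field; rewrite !gt_eqF.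
  transitivity ((x + s) / (t * Num.sqrt t) *
    (expR (- b * (x + s)) * expR (- ((x + s) ^+ 2 / (2 * t))))); first ring.
  by rewrite he; ring.
have [gt mt] := gtiltP m sg0.
have g1 : gint (fun s => c * ((s - m) * gtilt m sg s)) by apply: gintZ; exact: gint_tilt1.
have g2 : gint (fun s => c * (x + m) * gtilt m sg s) by exact: gintZ.
rewrite (funext E); split; first exact: gintD.
rewrite gmeanD// !gmeanZ//; last exact: gint_tilt1.
rewrite gmean_tilt1// mulr0 add0r mt /c /heat /sg /m.
rewrite (expRD (- b * x + b ^+ 2 / 2)).
by field; rewrite !gt_eqF.
Qed.

(** The tilted [heat] without its factor t^(-3/2). Compensating this factor by moving the frame is
    what produces the correction [3 / (2 * b) * ln n]. *)
Definition front (A t z : R) : R := A * (expR (- b * z) * (z * expR (- (z ^+ 2 / (2 * t))))).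

Lemma front_heat A t z : 0 < t ->
  front A t z = A * (t * Num.sqrt t) * (expR (- b * z) * heat t z).
Proof.
move=> t0; have st0 : 0 < Num.sqrt t by rewrite sqrtr_gt0.
by rewrite /front /heat; field; rewrite !gt_eqF.
Qed.

Lemma measurable_front A t : measurable_fun setT (front A t).
Proof.
apply: measurable_funM => //; apply: measurable_funM.
  by apply: measurableT_comp => //; exact: measurable_funM.
apply: measurable_funM => //; apply: measurableT_comp => //.
by apply: measurableT_comp => //; apply: measurable_funM.
Qed.

(** Up to [z1] the trivial bound 1 on a probability replaces the front, which is negative for
    [z < 0]. *)
Definition capped (A t z1 z : R) : R := if z <= z1 then 1 else front A t z.

Lemma measurable_capped A t z1 : measurable_fun setT (capped A t z1).
Proof.
rewrite /capped; apply: measurable_fun_if => //.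
  exact: measurable_fun_ler.
by apply: measurable_funTS; exact: measurable_front.
Qed.

Lemma front_ub A t z : 0 < t -> 0 <= A -> 0 <= z -> front A t z <= A * expR (- b * z) * z.
Proof.
move=> t0 A0 z0; rewrite /front -(mulrA A) ler_wpM2l// ler_wpM2l ?expR_ge0//.
rewrite ler_piMr// expR_le1 oppr_le0 divr_ge0 ?sqr_ge0//; lra.
Qed.

Lemma mul_expRN_le z : z * expR (- b * z) <= b^-1.
Proof.
have e0 := expR_gt0 (b * z).
rewrite mulNr expRN ler_pdivrMr// -ler_pdivrMl ?invr_gt0// invrK.
by have := expR_ge1Dx (b * z); lra.
Qed.

Lemma gint_capped A t z1 x : 0 < t -> 0 <= A -> 0 <= z1 -> gint (fun s => capped A t z1 (x + s)).
Proof.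
move=> t0 A0 z10; apply: (@gint_bounded _ _ (1 + A / b)).
  by apply: measurable_shift; exact: measurable_capped.
move=> s; set z := x + s; rewrite /capped.
have Ab : 0 <= A / b by rewrite divr_ge0// ltW.
case: (leP z z1) => zz1; first by rewrite normr1; lra.
have z0 : 0 <= z by lra.
rewrite ger0_norm; last by rewrite /front !mulr_ge0 ?expR_ge0.
rewrite (le_trans (front_ub _ _ _))//.
have := ler_wpM2l A0 (mul_expRN_le z); lra.
Qed.

(* Just below the cap the profile exceeds the cap [1] by a factor proportional to [A], which
   outweighs the Gaussian mass that a walk started beyond [z1] sends below [0]. *)
Lemma capped_le_front : exists z0 : R, forall z1 A t x,
  z0 <= z1 -> 4 * expR (b * z1) <= A -> z1 ^+ 2 <= t -> z1 - 1 + b <= x ->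
  gmean (fun s => capped A t z1 (x + s)) <= gmean (fun s => front A t (x + s)).
Proof.
pose c1 : R := expR (- (2 * b)) / 4.
have c10 : 0 < c1 by rewrite divr_gt0 ?expR_gt0.
have gp := @gpeak_gt0 R.
pose k := 2 * expR 1 / (c1 * gpeak).
have k0 : 0 < k by rewrite divr_gt0 ?mulr_gt0 ?expR_gt0.
exists (3 + 2 * k) => z1 A t x hz hA ht hx.
have z12 : 2 <= z1 by lra.
have b1 : 0 <= b by exact: ltW.
have e1 : 1 <= expR (b * z1) by apply: one_le_expR; rewrite mulr_ge0//; lra.
have A1 : 4 <= A by lra.
have t0 : 0 < t by nra.
have [gh _] := heat_tilt x t0.
have gf : gint (fun s => front A t (x + s)).
  rewrite (_ : (fun s => _) = fun s => A * (t * Num.sqrt t) *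
    (expR (- b * (x + s)) * heat t (x + s))); last by apply/funext => s; exact: front_heat.
  exact: gintZ.
have gc : gint (fun s => capped A t z1 (x + s)) by apply: gint_capped => //; lra.
rewrite -subr_le0 -gmeanB//.
pose ind (s : R) : R := \1_`[(1 - x), (2 - x)]%classic s.
have gi : gint ind.
  apply: (@gint_bounded _ _ 1); first exact: measurable_indic.
  by move=> s; rewrite /ind indicE; case: (_ \in _); rewrite ?normr1 ?normr0.
have gx : gint (fun s => expR (- x * s)) by exact: gint_exp.
(* Pointwise majorant of the capped profile minus the front. The exponential pays for [z < 1 / 2];
   from there to [z1] the front is at least 1, and on [[1, 2]] it is at least
   [A * expR (- (2 * b)) / 2], half of which covers the cap while the other half is the gain
   [A * c1]. *)
pose g s := 2 * A * expR (x / 2 - x ^+ 2) * expR (- x * s) - A * c1 * ind s.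
have gg : gint g by apply: gintB; apply: gintZ.
have xb : 1 + b <= x by lra.
have half z : z <= z1 -> expR (- (1 / 2)) <= expR (- (z ^+ 2 / (2 * t))) \/ z < 0.
  move=> zz1; case: (ltP z 0) => z0; [by right|left].
  rewrite ler_expR lerN2 ler_pdivrMr ?mulr_gt0//.
  have : z ^+ 2 <= z1 ^+ 2 by rewrite ler_sqr// nnegrE; lra.
  lra.
have eh : 1 / 2 <= expR (- (1 / 2)) :> R by have := expR_ge1Dx (- (1 / 2) : R); lra.
apply: (@le_trans _ _ (gmean g)).
  apply: gmean_le => //; first exact: gintB.
  move=> s; rewrite /g.
  have -> : 2 * A * expR (x / 2 - x ^+ 2) * expR (- x * s) = 2 * A * expR (x * (1 / 2 - (x + s))).
    by rewrite -mulrA -expRD; congr (_ * expR _); ring.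
  have -> : ind s = (1 <= x + s <= 2)%R%:R.
    rewrite /ind indicE; congr (_%:R)%R; congr nat_of_bool.
    by apply/idP/idP; rewrite inE/= in_itv/=; lra.
  set z := x + s; rewrite /capped.
  have E0 := expR_gt0 (x * (1 / 2 - z)).
  have AE : 0 < 2 * A * expR (x * (1 / 2 - z)) by rewrite !mulr_gt0//; lra.
  case: (leP z z1) => zz1; last first.
    have -> : (1 <= z <= 2) = false by lra.
    by rewrite mulr0; lra.
  have [zh|zh] := ltP z (1 / 2).
    have -> : (1 <= z <= 2) = false by lra.
    rewrite mulr0 subr0.
    have [zp|zn] := leP 0 z.
      have f0 : 0 <= front A t z by rewrite /front !mulr_ge0 ?expR_ge0//; lra.
      have : 1 <= expR (x * (1 / 2 - z)) by apply: one_le_expR; rewrite mulr_ge0//; lra.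
      nra.
    (* the front is negative here, of size at most [A |z| exp (b |z|)] *)
    have h1 : - front A t z <= A * ((- z) * expR (- b * z)).
      rewrite /front -mulrN ler_pM2l; last lra.
      rewrite -mulrN -mulNr mulrC ler_pM2r ?expR_gt0//.
      rewrite -[leRHS]mulr1 ler_wpM2l//; first lra.
      by rewrite expR_le1 oppr_le0 divr_ge0 ?sqr_ge0//; lra.
    have h2 : - z <= expR (- z) by have := expR_ge1Dx (- z); lra.
    have h3 : (- z) * expR (- b * z) <= expR (x * (1 / 2 - z)).
      apply: (@le_trans _ _ (expR (- z) * expR (- b * z))).
        by rewrite ler_wpM2r ?expR_ge0.
      by rewrite -expRD ler_expR; nra.
    have h4 : 1 <= expR (x * (1 / 2 - z)) by apply: one_le_expR; rewrite mulr_ge0//; lra.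
    nra.
  have [h|] := half z zz1; last lra.
  have ez : expR (- b * z1) <= expR (- b * z) by rewrite ler_expR; nra.
  have eb : expR (- b * z1) * expR (b * z1) = 1 by rewrite -expRD mulNr addNr expR0.
  have ezp := expR_gt0 (- b * z1).
  have f1 : 1 <= front A t z.
    rewrite /front.
    have : 1 / 4 <= z * expR (- (z ^+ 2 / (2 * t))) by nra.
    set q := z * _ => hq.
    have : expR (- b * z1) * (1 / 4) <= expR (- b * z) * q by apply: ler_pM => //; lra.
    nra.
  have [/andP[z1' z2']|_] := boolP (1 <= z <= 2); last by rewrite mulr0 subr0; lra.
  rewrite mulr1.
  have e2 : expR (- (2 * b)) <= expR (- b * z) by rewrite ler_expR; nra.
  have e2b : expR (- (2 * b)) * expR (b * z1) >= 1.
    by rewrite -expRD; apply: one_le_expR; nra.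
  have : A * (expR (- (2 * b)) * (1 / 2)) <= front A t z.
    rewrite /front ler_pM2l; last lra.
    by apply: ler_pM; rewrite ?expR_ge0//; nra.
  have : 4 <= A * expR (- (2 * b)).
    have := expR_gt0 (- (2 * b)); nra.
  by rewrite /c1; lra.
rewrite /g gmeanB ?gmeanZ//; try exact: gintZ.
rewrite gmean_exp.
have : 1 * ((2 - x - (1 - x)) * (gpeak * expR (- ((x - 1) ^+ 2 / 2)))) <= gmean ind.
  apply: gmean_indic_ge => //; try (rewrite ler_norml; lra).
  - lra.
  - by move=> s hs; rewrite /ind indicE mem_set//= in_itv.
rewrite mul1r (_ : 2 - x - (1 - x) = 1) ?mul1r; last ring.
move=> hi.
rewrite subr_le0.
have -> : 2 * A * expR (x / 2 - x ^+ 2) * expR ((- x) ^+ 2 / 2) =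
    A * (2 * expR (x / 2 - x ^+ 2 + (- x) ^+ 2 / 2)) by rewrite [in RHS](expRD (x / 2 - x ^+ 2)); ring.
rewrite -(mulrA A) ler_pM2l; last lra.
apply: (@le_trans _ _ (c1 * (gpeak * expR (- ((x - 1) ^+ 2 / 2))))); last by rewrite ler_pM2l.
(* The mean of the gain exceeds that of the loss by a factor of order [expR (x / 2)]; [z0] was
   chosen to make this factor large enough. *)
have -> : - ((x - 1) ^+ 2 / 2) = (x / 2 - x ^+ 2 + (- x) ^+ 2 / 2) + (x / 2 - 1 / 2) by field.
rewrite [in leRHS]expRD; set eU := expR (_ + _ + _ / 2); set eV := expR (x / 2 - 1 / 2).
rewrite (_ : c1 * (gpeak * (eU * eV)) = eU * (eV * (c1 * gpeak))); last first.
  by rewrite mulrA (mulrC (c1 * gpeak)) mulrA.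
rewrite (mulrC 2) ler_pM2l ?expR_gt0// /eV.
have hx2 : k <= expR (x / 2 - 1 / 2) by have := expR_ge1Dx (x / 2 - 1 / 2); lra.
have : k * (c1 * gpeak) <= expR (x / 2 - 1 / 2) * (c1 * gpeak).
  by rewrite ler_pM2r// mulr_gt0.
rewrite /k divfK; last by rewrite gt_eqF// mulr_gt0.
by have := expR_ge1Dx (1 : R); lra.
Qed.

End heat.

Lemma expR_half_ln (R : realType) (t : R) : 0 < t -> expR (ln t / 2) = Num.sqrt t.
Proof.
move=> t0; rewrite -[RHS](_ : Num.sqrt (expR (ln t / 2) ^+ 2) = _).
  by rewrite sqrtr_sqr ger0_norm// expR_ge0.
by rewrite -expRM_natl mulrC divfK ?lnK.
Qed.

Section speed.
Context {R : realType}.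
Variable d : nat.
Hypothesis hd : (2 <= d)%N.

Definition speed : R := Num.sqrt (2 * ln d%:R).
Local Notation b := speed.

Lemma branching_ge2 : 2 <= d%:R :> R. Proof. by rewrite ler_nat. Qed.

Lemma ln_branching_gt0 : 0 < ln d%:R :> R.
Proof. by apply: ln_gt0; have := branching_ge2; lra. Qed.

Lemma speed_gt0 : 0 < b.
Proof. by rewrite sqrtr_gt0 mulr_gt0// ln_branching_gt0. Qed.

Lemma speed_sqr : b ^+ 2 = 2 * ln d%:R.
Proof. by rewrite sqr_sqrtr// mulr_ge0// ltW// ln_branching_gt0. Qed.

Lemma expR_half_speed_sqr : expR (b ^+ 2 / 2) = d%:R.
Proof.
have dp : 0 < d%:R :> R by have := branching_ge2; lra.
by rewrite speed_sqr mulrC mulKf// lnK.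
Qed.

(** This makes [b] the critical speed: branching and averaging multiply [expR (- b * z)] by
    [expR (b ^+ 2)], that is, they translate it by exactly [b]. *)
Lemma speedE : d%:R * expR (b ^+ 2 / 2) = expR (b ^+ 2).
Proof.
rewrite -{1}expR_half_speed_sqr -expRD; congr expR; by field.
Qed.

Lemma mean_maxE n : mean_max R d n = b * n%:R - 3 / (2 * b) * ln n%:R.
Proof. by []. Qed.

End speed.

Section front_step.
Context {R : realType}.
Variable b : R.
Hypothesis b0 : 0 < b.

(** The shift [s] absorbs the change of the factor t^(-3/2). The extra time [tau] buys the shift
    inside the Gaussian, through [(h + s)^2 / (T + tau) <= h^2 / T + s^2 / tau]. The amplitude pays
    for both this and the ratio of the times. *)
Lemma front_shift (A A' t T T' tau s h : R) : 0 <= A -> 0 < t -> 0 < T -> 0 < tau ->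
  T' = T + tau -> 0 <= s -> expR (- b * s) = (t * Num.sqrt t) / (T' * Num.sqrt T') ->
  A * expR (2 * tau / T + s ^+ 2 / (2 * tau)) <= A' -> 0 <= h ->
  A * (t * Num.sqrt t) * (expR (- b * h) * heat T h) <= front b A' T' (h + s).
Proof.
move=> A0 t0 T0 tau0 T'E s0 es AA' h0.
have T'0 : 0 < T' by lra.
have sT := T0; rewrite -sqrtr_gt0 in sT.
have sT' := T'0; rewrite -sqrtr_gt0 in sT'.
have st := t0; rewrite -sqrtr_gt0 in st.
rewrite /front (_ : - b * (h + s) = - b * h + - b * s); last ring.
rewrite expRD es /heat.
set e1 := expR (- b * h); set k := t * Num.sqrt t.
have k0 : 0 < k by rewrite mulr_gt0.
have e10 : 0 < e1 by exact: expR_gt0.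
have sq : (h + s) ^+ 2 / (2 * T') <= h ^+ 2 / (2 * T) + s ^+ 2 / (2 * tau).
  rewrite -subr_ge0 T'E.
  have -> : h ^+ 2 / (2 * T) + s ^+ 2 / (2 * tau) - (h + s) ^+ 2 / (2 * (T + tau)) =
      (tau * h - T * s) ^+ 2 / (2 * T * tau * (T + tau)).
    by field; rewrite !gt_eqF//; lra.
  by rewrite divr_ge0 ?sqr_ge0// !mulr_ge0//; lra.
have hT : T' * Num.sqrt T' <= T * Num.sqrt T * expR (2 * tau / T).
  have q1 : 1 <= T' / T by rewrite ler_pdivlMr// mul1r; lra.
  have -> : T' * Num.sqrt T' = T * Num.sqrt T * (T' / T * Num.sqrt (T' / T)).
    have -> : Num.sqrt T' = Num.sqrt (T' / T) * Num.sqrt T.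
      by rewrite -sqrtrM ?divfK ?gt_eqF// divr_ge0// ltW.
    by field; rewrite gt_eqF.
  rewrite ler_pM2l ?mulr_gt0//.
  apply: (@le_trans _ _ ((T' / T) ^+ 2)).
    rewrite ler_pM2l; last by rewrite divr_gt0.
    rewrite -{2}(sqr_sqrtr (_ : 0 <= T' / T)); last lra.
    rewrite expr2 ler_peMl ?sqrtr_ge0//.
    by rewrite -{1}sqrtr1 ler_sqrt//; lra.
  rewrite -mulrA expRM_natl lerXn2r ?nnegrE ?expR_ge0//; first lra.
  rewrite (_ : T' / T = 1 + tau / T); first exact: expR_ge1Dx.
  by rewrite T'E mulrDl divff// gt_eqF.
have hA : A * (T' * Num.sqrt T') * expR (s ^+ 2 / (2 * tau)) <= A' * (T * Num.sqrt T).
  apply: (@le_trans _ _ (A * (T * Num.sqrt T * expR (2 * tau / T)) * expR (s ^+ 2 / (2 * tau)))).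
    by rewrite ler_wpM2r ?expR_ge0// ler_wpM2l.
  move: AA'; rewrite expRD -(ler_pM2r (mulr_gt0 T0 sT)); lra.
have -> : A * k * (e1 * (h * expR (- (h ^+ 2 / (2 * T))) / (T * Num.sqrt T))) =
    k * e1 / (T * Num.sqrt T) / (T' * Num.sqrt T') * h *
    (A * (T' * Num.sqrt T') * expR (- (h ^+ 2 / (2 * T)))).
  by field; rewrite !gt_eqF.
have -> : A' * (e1 * (k / (T' * Num.sqrt T')) *
      ((h + s) * expR (- ((h + s) ^+ 2 / (2 * T'))))) =
    k * e1 / (T * Num.sqrt T) / (T' * Num.sqrt T') * (h + s) *
    (A' * (T * Num.sqrt T) * expR (- ((h + s) ^+ 2 / (2 * T')))).
  by field; rewrite !gt_eqF.
have c0 : 0 <= k * e1 / (T * Num.sqrt T) / (T' * Num.sqrt T').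
  by rewrite !divr_ge0 ?mulr_ge0// ltW.
apply: ler_pM.
- by rewrite mulr_ge0.
- by rewrite !mulr_ge0 ?expR_ge0// ltW.
- by rewrite ler_wpM2l//; lra.
apply: (@le_trans _ _ (A * (T' * Num.sqrt T') * expR (s ^+ 2 / (2 * tau)) *
    expR (- ((h + s) ^+ 2 / (2 * T'))))).
  rewrite -[leRHS]mulrA ler_wpM2l//; first by rewrite !mulr_ge0// ltW.
  by rewrite -expRD ler_expR; lra.
by rewrite ler_wpM2r ?expR_ge0.
Qed.

(* [r] and [r'] stand for the square roots of two consecutive (shifted) times. *)
Lemma front_step_size (r r' : R) : 1 <= r -> 0 <= r' -> r' ^+ 2 = r ^+ 2 + 1 ->
  let tau := r' - r in let t := r ^+ 2 + r in
  let s := 3 / (2 * b) * (ln (r' ^+ 2 + r') - ln t) in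
  [/\ 0 < tau, 0 <= s, s <= 3 / (b * r ^+ 2),
   (r ^+ 3)^-1 <= 6 * (r^-1 - r'^-1) &
   2 * tau / (t + 1) + s ^+ 2 / (2 * tau) <= 6 * (1 + 14 / b ^+ 2) * (r^-1 - r'^-1)].
Proof.
move=> r1 r'0 r'E tau t s.
have r0 : 0 < r by lra.
have rr' : r < r' by nra.
have r'r : r' <= 2 * r by nra.
have tau0 : 0 < tau by rewrite /tau; lra.
have tauM : tau * (r + r') = 1 by rewrite /tau; nra.
have tauL : (3 * r)^-1 <= tau by rewrite -[_^-1]mul1r ler_pdivrMr ?mulr_gt0//; nra.
have tauU : tau <= (2 * r)^-1 by rewrite -[_^-1]mul1r ler_pdivlMr ?mulr_gt0//; nra.
have t0 : 0 < t by rewrite /t; nra.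
have T'0 : 0 < r' ^+ 2 + r' by nra.
have T'E : r' ^+ 2 + r' = t + (1 + tau) by rewrite /t /tau r'E; ring.
have sE : s = 3 / (2 * b) * ln (1 + (1 + tau) / t).
  rewrite /s -ln_div ?posrE// T'E; congr (_ * ln _); field; exact: lt0r_neq0.
have q0 : 0 <= (1 + tau) / t by rewrite divr_ge0//; lra.
have s0 : 0 <= s.
  by rewrite sE mulr_ge0 ?ln_ge0 ?divr_ge0 ?mulr_ge0// ?(ltW b0)//; lra.
have sU : s <= 3 / (b * r ^+ 2).
  apply: (@le_trans _ _ (3 / (2 * b) * (2 / r ^+ 2))).
    rewrite sE ler_wpM2l//; first by rewrite divr_ge0// mulr_ge0// ltW.
    apply: (@le_trans _ _ ((1 + tau) / t)); first by apply: le_ln1Dx; lra.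
    have tau1 : tau <= 1 by nra.
    apply: ler_pM; rewrite ?invr_ge0; try lra.
    by rewrite lef_pV2 ?posrE// /t; nra.
  by rewrite le_eqVlt; apply/orP; left; apply/eqP; field; rewrite !gt_eqF.
(* The time runs ahead by its square root, so [tau] has order [1 / r]. Both errors then have order
   [1 / r^3], which is the order of the decrement of [1 / r], and they telescope to a bounded
   total. *)
have r30 : 0 < (r ^+ 3)^-1 by rewrite invr_gt0 exprn_gt0.
have h1 : 2 * tau / (t + 1) <= (r ^+ 3)^-1.
  rewrite ler_pdivrMr; last lra.
  apply: (@le_trans _ _ (r^-1)).
    by apply: (@le_trans _ _ (2 * (2 * r)^-1)); [lra|rewrite invfM mulrA divff ?mul1r].
  have -> : r^-1 = (r ^+ 3)^-1 * r ^+ 2 by field; rewrite gt_eqF.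
  by rewrite ler_wpM2l ?(ltW r30)// /t; nra.
have h2 : s ^+ 2 / (2 * tau) <= 14 / b ^+ 2 * (r ^+ 3)^-1.
  rewrite ler_pdivrMr; last lra.
  apply: (@le_trans _ _ ((3 / (b * r ^+ 2)) ^+ 2)).
    by rewrite lerXn2r ?nnegrE// (le_trans s0).
  apply: (@le_trans _ _ (14 / b ^+ 2 * (r ^+ 3)^-1 * (2 * (3 * r)^-1))); last first.
    have a0 : 0 <= 14 / b ^+ 2 * (r ^+ 3)^-1.
      by rewrite mulr_ge0 ?(ltW r30)// divr_ge0// sqr_ge0.
    by rewrite ler_wpM2l//; lra.
  rewrite -subr_ge0 (_ : _ - _ = (1 / 3) / (b ^+ 2 * r ^+ 4)).
    apply: divr_ge0; first lra.
    by apply: mulr_ge0; [exact: sqr_ge0|apply: exprn_ge0; exact: ltW].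
  by field; rewrite !gt_eqF.
have h3 : (r ^+ 3)^-1 <= 6 * (r^-1 - r'^-1).
  have -> : r^-1 - r'^-1 = tau / (r * r').
    by rewrite /tau; field; rewrite !gt_eqF//; lra.
  rewrite mulrA ler_pdivlMr; last by rewrite mulr_gt0//; lra.
  rewrite mulrC ler_pdivrMr ?exprn_gt0//.
  have : 1 <= tau * (3 * r) by rewrite -ler_pdivrMr ?mul1r ?mulr_gt0.
  have : 0 <= r ^+ 2 by exact: sqr_ge0.
  have -> : 6 * tau * r ^+ 3 = 2 * r ^+ 2 * (tau * (3 * r)) by ring.
  by nra.
split => //.
have k0 : 0 <= 14 / b ^+ 2 by rewrite divr_ge0// sqr_ge0.
nra.
Qed.

End front_step.

Section supersolution.
Context {R : realType}.
Variable d : nat.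
Hypothesis hd : (2 <= d)%N.
Local Notation b := (@speed R d).
Local Notation b0 := (@speed_gt0 R d hd).
Local Notation F := (@Fr R d).

(** Union bound over the children, in the form [1 - d (1 - p) <= p ^ d]. *)
Lemma Fr_compl_step n x : 1 - F n.+1 x <= d%:R * gmean (fun s => 1 - F n (x + s)).
Proof.
have gF := @gint_Fr R d n x; rewrite gmeanB ?gmean_cst//=; last exact: gint_cst.
have := @gmean_Fr_ge0 R d n x; have := @gmean_Fr_le1 R d n x.
set p := gmean _ => p1 p0.
suff : 1 - d%:R * (1 - p) <= p ^+ d by lra.
elim: d => [|k IH]; first by rewrite expr0; lra.
have [h|h] := leP 0 (1 - k%:R * (1 - p)).
  rewrite exprS; apply: (@le_trans _ _ (p * (1 - k%:R * (1 - p)))); last by rewrite ler_wpM2l.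
  rewrite -natr1; have : 0 <= k%:R * (1 - p) ^+ 2 by rewrite mulr_ge0 ?sqr_ge0.
  nra.
by rewrite (le_trans _ (exprn_ge0 _ p0))// -natr1; nra.
Qed.

Lemma capped_ge0 A t z1 z : 0 <= A -> 0 <= z1 -> 0 <= capped b A t z1 z.
Proof.
move=> A0 z10; rewrite /capped; case: (leP z z1) => // zz.
by rewrite /front !mulr_ge0 ?expR_ge0//; lra.
Qed.

(** One step of the linearised recursion. The threshold is [z1 - 1] rather than [z1] because the
    frame afterwards moves by up to 1. *)
Lemma capped_step A t z1 n x (y : R) : 0 < t -> 0 <= A -> 0 <= z1 ->
  (forall x, 1 - F n x <= capped b A t z1 (x + y)) ->
  (forall x, z1 - 1 + b <= x ->
     gmean (fun s => capped b A t z1 (x + s)) <= gmean (fun s => front b A t (x + s))) ->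
  z1 - 1 <= x + y - b ->
  1 - F n.+1 x <= A * (t * Num.sqrt t) * (expR (- b * (x + y - b)) * heat (t + 1) (x + y - b)).
Proof.
move=> t0 A0 z10 H Hc hx.
apply: (le_trans (Fr_compl_step n x)).
have gc : gint (fun s => capped b A t z1 (x + y + s)) by apply: gint_capped => //; exact: b0.
have h1 : gmean (fun s => 1 - F n (x + s)) <= gmean (fun s => capped b A t z1 (x + y + s)).
  apply: gmean_le => //; first by apply: gintB; [exact: gint_cst|exact: gint_Fr].
  by move=> s; rewrite (_ : x + y + s = x + s + y); [exact: H|ring].
have h2 := Hc (x + y); have [gh mh] := heat_tilt b (x + y) t0.
have fE : (fun s => front b A t (x + y + s)) = fun s => A * (t * Num.sqrt t) *
    (expR (- b * (x + y + s)) * heat t (x + y + s)).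
  by apply/funext => s; exact: front_heat.
rewrite fE gmeanZ// mh in h2.
have d0 : 0 <= d%:R :> R by [].
apply: (@le_trans _ _ (d%:R * (A * (t * Num.sqrt t) *
    (expR (- b * (x + y) + b ^+ 2 / 2) * heat (t + 1) (x + y - b))))).
  by rewrite ler_wpM2l// (le_trans h1)// h2//; lra.
rewrite expRD le_eqVlt; apply/orP; left; apply/eqP.
rewrite [in RHS](_ : - b * (x + y - b) = - b * (x + y) + b ^+ 2); last ring.
by rewrite (expRD _ (b ^+ 2)) -(speedE hd); ring.
Qed.

(** In a frame of speed [b] with the logarithmic correction [a n], the complement [1 - F n] stays
    below a capped front of bounded amplitude; [C] is a distance at which this front has dropped to
    1/2. *)
Lemma Fr_mean_max_ge_half : exists2 C : R, 0 <= C &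
  forall n, (1 <= n)%N -> 1 / 2 <= F n (mean_max R d n + C).
Proof.
have b0 := b0.
have [z0 Hz0] := capped_le_front b0.
pose z1 := Num.max z0 2.
have z12 : 2 <= z1 by rewrite le_max lexx orbT.
have z1z0 : z0 <= z1 by rewrite le_max lexx.
(* The three summands ensure [1 <= r n], [z1 ^+ 2 <= t n] and that each correction of the frame is
   at most 1. *)
pose M0 := 1 + z1 ^+ 2 + 3 / b.
have b30 : 0 <= 3 / b by rewrite divr_ge0// ltW.
have M01 : 1 <= M0 by rewrite /M0; nra.
pose r n := Num.sqrt (n%:R + M0).
have m0 n : 1 <= n%:R + M0 by have : 0 <= n%:R :> R by []; lra.
have r2 n : r n ^+ 2 = n%:R + M0 by rewrite sqr_sqrtr//; have := m0 n; lra.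
have r0' n : 0 <= r n by exact: sqrtr_ge0.
have r1 n : 1 <= r n by have := r2 n; have := m0 n; have := r0' n; nra.
pose t n := r n ^+ 2 + r n.
have t0 n : 0 < t n by rewrite /t; have := r1 n; nra.
have tz n : z1 ^+ 2 <= t n.
  by rewrite /t r2 /M0; have := r1 n; have : 0 <= n%:R :> R by []; lra.
pose a n := 3 / (2 * b) * (ln (t n) - ln (t 0%N)).
pose Cg := 6 * (1 + 14 / b ^+ 2).
have Cg0 : 0 <= Cg by rewrite mulr_ge0// addr_ge0// divr_ge0// sqr_ge0.
pose A0 := 4 * expR (b * z1).
have A00 : 0 < A0 by rewrite mulr_gt0 ?expR_gt0.
(* The amplitude collects the errors of [front_step_size]; their telescoping sum keeps it below
   [Am]. *)
pose A n := A0 * expR (Cg * ((r 0%N)^-1 - (r n)^-1)).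
have rV n : (r n)^-1 <= (r 0%N)^-1.
  rewrite lef_pV2 ?posrE; [|have := r1 n; lra|have := r1 0%N; lra].
  by rewrite ler_sqrt ?lerD2r//; have := m0 n; lra.
have AA0 n : A0 <= A n.
  by rewrite ler_peMr ?(ltW A00)//; apply: one_le_expR; rewrite mulr_ge0// subr_ge0.
have An0 n : 0 <= A n by have := AA0 n; lra.
have z10 : 0 <= z1 by lra.
have step n : let tau := r n.+1 - r n in let s := a n.+1 - a n in
    [/\ t n.+1 = t n + 1 + tau, 0 < tau, 0 <= s <= 1,
     expR (- b * s) = (t n * Num.sqrt (t n)) / (t n.+1 * Num.sqrt (t n.+1)) &
     A n * expR (2 * tau / (t n + 1) + s ^+ 2 / (2 * tau)) <= A n.+1].
  move=> tau s.
  have rE : r n.+1 ^+ 2 = r n ^+ 2 + 1 by rewrite !r2 -natr1; ring.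
  have /= := front_step_size b0 (r1 n) (r0' n.+1) rE.
  have -> : 3 / (2 * b) * (ln (r n.+1 ^+ 2 + r n.+1) - ln (r n ^+ 2 + r n)) = s.
    by rewrite /s /a /t; ring.
  rewrite -/(t n) -/tau => -[tau0 s0 s1 _ hs]; split => //.
  - by rewrite /t rE /tau; ring.
  - rewrite s0 (le_trans s1)// ler_pdivrMr ?mul1r; last by rewrite mulr_gt0// exprn_gt0//; have := r1 n; lra.
    rewrite -ler_pdivrMl// mulrC r2 /M0; have : 0 <= n%:R :> R by [].
    have := sqr_ge0 z1; lra.
  - have E u : 0 < u -> u * Num.sqrt u = expR (3 / 2 * ln u).
      move=> u0; rewrite -expR_half_ln// -{1}(lnK u0) -expRD; congr expR; by field.
    rewrite !E// -expRN -expRD; congr expR; rewrite /s /a.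
    by field; rewrite gt_eqF.
  - rewrite /A -mulrA -expRD ler_pM2l// ler_expR -lerBrDl -mulrBr.
    by apply: (le_trans hs); rewrite -/Cg le_eqVlt; apply/orP; left; apply/eqP; ring.
have main n : forall x, 1 - F n x <= capped b (A n) (t n) z1 (x - b * n%:R + a n).
  elim: n => [|n IH] x.
    have -> : x - b * 0%:R + a 0%N = x by rewrite /a; ring.
    rewrite /=; case: (leP 0 x) => x0.
      by rewrite subrr; exact: capped_ge0.
    by rewrite /capped subr0 ifT//; lra.
  have [tE tau0 /andP[s0 s1] es AA] := step n.
  rewrite /capped; case: (leP _ z1) => hz; first by rewrite lerBlDr lerDl Fr_ge0.
  set s := a n.+1 - a n in s0 s1 es AA.
  have zE : x - b * n.+1%:R + a n.+1 = x + (- (b * n%:R) + a n) - b + s.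
    by rewrite /s -natr1; ring.
  rewrite zE in hz *.
  apply: (le_trans (@capped_step (A n) (t n) z1 n x (- (b * n%:R) + a n) _ _ _ _ _ _)) => //.
  - by move=> y; rewrite addrA; exact: IH.
  - by move=> y; apply: Hz0 => //; exact: AA0.
  - lra.
  have tn := t0 n; apply: (front_shift _ _ _ tau0 tE) => //; lra.
pose Am := A0 * expR (Cg * (r 0%N)^-1).
have AAm n : A n <= Am.
  rewrite ler_pM2l// ler_expR ler_wpM2l// gerBl invr_ge0//.
have Am0 : 0 < Am by rewrite mulr_gt0 ?expR_gt0.
(* As [z * expR (- b * z)] is at most [4 / (b ^+ 2 * z)], the front is at most 1/2 once [z] reaches
   [8 * Am / b ^+ 2]. The constant [c0] undoes the normalisation of [a] at time 0. *)
pose Z := z1 + 8 * Am / b ^+ 2.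
have Z0 : 0 <= Z by rewrite addr_ge0// divr_ge0 ?sqr_ge0// mulr_ge0// ltW.
pose c0 := 3 / (2 * b) * `|ln (t 0%N)|.
have c00 : 0 <= c0 by rewrite mulr_ge0 ?normr_ge0 ?divr_ge0// mulr_ge0// ltW.
exists (Z + c0) => [|n n1]; first by rewrite addr_ge0.
have := main n (mean_max R d n + (Z + c0)).
set z := _ + a n => Hm; suff : capped b (A n) (t n) z1 z <= 1 / 2 by lra.
have k0 : 0 <= 3 / (2 * b) by rewrite divr_ge0// mulr_ge0// ltW.
have zZ : Z <= z.
  have np : 0 < n%:R :> R by rewrite ltr0n.
  have : ln (n%:R) <= ln (t n).
    by rewrite ler_ln ?posrE// /t r2; have := r1 n; lra.
  rewrite /z /a mean_maxE /c0 => /(ler_wpM2l k0).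
  have := ler_wpM2l k0 (ler_norm (ln (t 0%N))).
  by rewrite !mulrBr; lra.
have Zz1 : z1 < Z by rewrite ltrDl divr_gt0 ?exprn_gt0// mulr_gt0.
have -> : capped b (A n) (t n) z1 z = front b (A n) (t n) z.
  by rewrite /capped leNgt (lt_le_trans Zz1 zZ).
have z0' : 0 <= z by lra.
apply: (le_trans (front_ub b (t0 n) (An0 n) z0')).
have bh0 : 0 < b / 2 by lra.
have hh := mul_expRN_le bh0 z.
rewrite invf_div in hh.
have -> : expR (- b * z) = expR (- (b / 2) * z) * expR (- (b / 2) * z).
  by rewrite -expRD; congr expR; by field.
set e := expR (- (b / 2) * z) in hh *.
have e0 : 0 < e by exact: expR_gt0.
have eE : e * (b / 2 * z) <= 1.
  have := expR_ge1Dx (b / 2 * z); have : e * expR (b / 2 * z) = 1.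
    by rewrite -expRD mulNr addNr expR0.
  nra.
have hz : 8 * Am / b ^+ 2 <= z by rewrite /Z in zZ; lra.
have hAz : 4 * Am / b <= b / 2 * z.
  have -> : 4 * Am / b = b / 2 * (8 * Am / b ^+ 2) by field; rewrite gt_eqF.
  by rewrite ler_pM2l.
apply: (@le_trans _ _ (Am * e * (2 / b))).
  have -> : A n * (e * e) * z = A n * e * (z * e) by ring.
  apply: ler_pM => //.
  - by rewrite mulr_ge0// ltW.
  - by rewrite mulr_ge0// ltW.
  - by rewrite ler_pM2r.
have -> : Am * e * (2 / b) = e * (4 * Am / b) / 2 by field; rewrite gt_eqF.
have : e * (4 * Am / b) <= e * (b / 2 * z) by rewrite ler_pM2l.
lra.
Qed.

End supersolution.

(** * The lower bound for the maximum *)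

(** A converse to the union bound up to second order: multiply by [(1 + p) ^+ d], bounded below by
    Bernoulli's inequality, and use that [1 - p ^+ 2] is at most 1. *)
Lemma one_sub_exp_ge (R : realType) (p : R) (d : nat) : 0 <= p <= 1 ->
  d%:R * p - (d%:R * p) ^+ 2 <= 1 - (1 - p) ^+ d.
Proof.
move=> /andP[p0 p1]; set q := d%:R * p.
have q0 : 0 <= q by rewrite mulr_ge0.
have bern : 1 + q <= (1 + p) ^+ d.
  rewrite /q; elim: d {q q0} => [|k IH]; first by rewrite expr0; lra.
  rewrite exprS -natr1; apply: (@le_trans _ _ ((1 + p) * (1 + k%:R * p))).
    have : 0 <= k%:R * p ^+ 2 by rewrite mulr_ge0 ?sqr_ge0.
    by nra.
  by rewrite ler_wpM2l//; lra.
have h : (1 - p) ^+ d * (1 + q) <= 1.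
  apply: (@le_trans _ _ ((1 - p) ^+ d * (1 + p) ^+ d)).
    by rewrite ler_wpM2l// exprn_ge0//; lra.
  by rewrite -exprMn exprn_ile1//; nra.
have e0 : 0 <= (1 - p) ^+ d by rewrite exprn_ge0//; lra.
have : (1 - p) ^+ d <= 1 - q + q ^+ 2.
  have : 1 <= (1 - q + q ^+ 2) * (1 + q).
    by rewrite (_ : _ * _ = 1 + q ^+ 3) ?lerDl ?exprn_ge0//; ring.
  have q1 : 0 < 1 + q by lra.
  by move=> h2; rewrite -(ler_pM2r q1); lra.
lra.
Qed.

Section subsolution.
Context {R : realType}.
Variable d : nat.
Hypothesis hd : (2 <= d)%N.
Local Notation b := (@speed R d).
Local Notation b0 := (@speed_gt0 R d hd).
Local Notation F := (@Fr R d).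

Lemma one_sub_Fr1_ge (x : R) : 0 <= x ->
  1 / 2 * (gpeak * expR (- ((x + 1) ^+ 2 / 2))) <= 1 - F 1 x.
Proof.
move=> x0 /=.
set p := gmean _.
have gF := @gint_Fr R d 0 x.
have p0 : 0 <= p by exact: (@gmean_Fr_ge0 R d 0 x).
have p1 : p <= 1 by exact: (@gmean_Fr_le1 R d 0 x).
have pd : p ^+ d <= p.
  case: d hd => [//|k _]; rewrite exprS ler_piMr//.
  by rewrite exprn_ile1.
have -> : 1 / 2 = - x - 1 / 2 - (- x - 1) :> R by field.
apply: (@le_trans _ _ (gmean (fun s => 1 - F 0 (x + s)))); last first.
  by rewrite gmeanB ?gmean_cst//; [rewrite -/p; lra|exact: gint_cst].
rewrite -[leLHS]mul1r; apply: gmean_indic_ge => //.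
- lra.
- by rewrite ler_norml; lra.
- by rewrite ler_norml; lra.
- by apply: gintB => //; exact: gint_cst.
- by move=> s; rewrite subr_ge0 Fr_le1.
- move=> s hs /=; have -> : (0 <= x + s) = false by lra.
  by rewrite subr0.
Qed.

(** Since [heat] is negative on the negative axis, the bound assumed for [y >= b n] holds for all
    [y], and the whole-line average can be taken. Only the quadratic term of the recursion is
    lost. *)
Lemma one_sub_Fr_step n (x : R) (B t : R) : 0 < t -> 0 <= B ->
  (forall y, b * n%:R <= y -> B * (expR (- b * (y - b * n%:R)) * heat t (y - b * n%:R)) <= 1 - F n y) ->
  let y := x - b * n.+1%:R in 0 <= y ->
  let q := B * (expR (- b * y) * heat (t + 1) y) in
  q - q ^+ 2 <= 1 - F n.+1 x.
Proof.
move=> t0 B0 H y y0 /=; set q := B * (expR (- b * y) * heat (t + 1) y).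
have [gh mh] := heat_tilt b (x - b * n%:R) t0.
pose p := gmean (fun s => 1 - F n (x + s)).
have gF := @gint_Fr R d n x.
have g1 : gint (fun s => 1 - F n (x + s)) by apply: gintB => //; exact: gint_cst.
have pE : p = 1 - gmean (fun s => F n (x + s)).
  by rewrite /p gmeanB ?gmean_cst//; exact: gint_cst.
have p01 : 0 <= p <= 1.
  by rewrite pE; have := @gmean_Fr_ge0 R d n x; have := @gmean_Fr_le1 R d n x; lra.
have d0 : 0 < d%:R :> R by have := @branching_ge2 R d hd; lra.
have heat0 (z : R) : z <= 0 -> heat t z <= 0.
  move=> z0; rewrite /heat mulr_le0_ge0 ?invr_ge0 ?mulr_ge0 ?sqrtr_ge0//; last exact: ltW.
  by rewrite mulr_le0_ge0 ?expR_ge0.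
have qp : q <= d%:R * p.
  have -> : q = d%:R * (B * gmean (fun s => expR (- b * (x - b * n%:R + s)) * heat t (x - b * n%:R + s))).
    rewrite mh expRD (_ : x - b * n%:R - b = y); last by rewrite /y -natr1; ring.
    rewrite /q (_ : - b * y = - b * (x - b * n%:R) + b ^+ 2); last by rewrite /y -natr1; ring.
    by rewrite (expRD _ (b ^+ 2)) -(speedE hd); ring.
  rewrite ler_pM2l// -gmeanZ//; apply: gmean_le => //; first exact: gintZ.
  move=> s; rewrite (_ : x - b * n%:R + s = x + s - b * n%:R); last ring.
  have [h|h] := leP (b * n%:R) (x + s); first exact: H.
  apply: (@le_trans _ _ 0); last by rewrite subr_ge0 Fr_le1.
  by rewrite mulr_ge0_le0// mulr_ge0_le0 ?expR_ge0// heat0//; lra.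
have q0 : 0 <= q.
  by rewrite /q /heat !mulr_ge0 ?expR_ge0 ?invr_ge0 ?mulr_ge0 ?sqrtr_ge0//; lra.
have dp0 : 0 <= q / d%:R <= 1.
  rewrite divr_ge0 ?(ltW d0)//= ler_pdivrMr// mul1r.
  by apply: (le_trans qp); rewrite ler_piMr ?(ltW d0)//; lra.
have := one_sub_exp_ge d dp0; rewrite mulrC divfK ?gt_eqF// => h.
apply: (le_trans h); rewrite lerB//= lerXn2r ?nnegrE//.
- exact: gmean_Fr_ge0.
- by move: dp0; lra.
- rewrite -[leLHS](_ : 1 - p = _); last by rewrite pE; ring.
  by rewrite lerB// ler_pdivrMr// mulrC.
Qed.

(** Without a logarithmic correction of the frame, the factor t^(-3/2) of [heat] appears directly at
    distance 1. *)
Lemma one_sub_Fr_speed_ge : exists2 c : R, 0 < c &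
  forall n, (1 <= n)%N -> c / (n%:R * Num.sqrt n%:R) <= 1 - F n (b * n%:R + 1).
Proof.
have b0 := b0; have gp := @gpeak_gt0 R.
pose e := expR (- 1 - (b + 1) ^+ 2 / 2).
have e0 : 0 < e by exact: expR_gt0.
pose A := Num.min (b / 24) (gpeak / 32 * e).
have A0 : 0 < A by rewrite lt_min !mulr_gt0//; lra.
have A1 : A <= b / 24 by rewrite ge_min lexx.
have A2 : A <= gpeak / 32 * e by rewrite ge_min lexx orbT.
pose r n : R := Num.sqrt n%:R.
have r2 n : r n ^+ 2 = n%:R by rewrite sqr_sqrtr.
have r0 n : 0 <= r n by exact: sqrtr_ge0.
have r1 n : (1 <= n)%N -> 1 <= r n.
  move=> n1; have : 1 <= n%:R :> R by rewrite ler1n.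
  by have := r2 n; have := r0 n; nra.
(* The amplitude decreases from [2 * A] towards [A]; its decrements, of order n^(-3/2), pay for the
   quadratic losses. *)
pose B n := A * (1 + (r n)^-1).
(* The offset gives time 1/4 at level 1, so that the initial profile contains [expR (- 2 * y ^+ 2)]
   and decays faster than the Gaussian bound of [one_sub_Fr1_ge]. *)
pose t (n : nat) : R := n%:R - 3 / 4.
have main n : (1 <= n)%N -> forall x, b * n%:R <= x ->
    B n * (expR (- b * (x - b * n%:R)) * heat (t n) (x - b * n%:R)) <= 1 - F n x.
  case: n => // n _; elim: n => [|n IH] x hx.
    set y := x - b * 1; have y0 : 0 <= y by rewrite subr_ge0.
    have x0 : 0 <= x by apply: le_trans hx; rewrite mulr1 ltW.
    apply: le_trans (one_sub_Fr1_ge x0).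
    have t1 : t 1%N = 1 / 4 by rewrite /t; lra.
    have s1 : Num.sqrt (1 / 4) = 1 / 2 :> R.
      by rewrite -[RHS]ger0_norm ?divr_ge0// -sqrtr_sqr; congr Num.sqrt; field.
    have B1 : B 1%N = 2 * A by rewrite /B /r sqrtr1 invr1; ring.
    rewrite B1 /heat t1 s1.
    have -> : 2 * A * (expR (- b * y) * (y * expR (- (y ^+ 2 / (2 * (1 / 4)))) / (1 / 4 * (1 / 2)))) =
        A * 16 * (y * (expR (- b * y) * expR (- (y ^+ 2 / (2 * (1 / 4)))))) by field.
    rewrite -expRD.
    have ye : y <= expR y by have := expR_ge1Dx y; lra.
    apply: (@le_trans _ _ (gpeak / 32 * e * 16 * (expR y * expR (- b * y + - (y ^+ 2 / (2 * (1 / 4))))))).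
      apply: ler_pM; rewrite ?mulr_ge0 ?expR_ge0//; [lra|lra|].
      by rewrite ler_pM2r ?expR_gt0.
    have -> : gpeak / 32 * e * 16 * (expR y * expR (- b * y + - (y ^+ 2 / (2 * (1 / 4))))) =
        1 / 2 * (gpeak * (e * (expR y * expR (- b * y + - (y ^+ 2 / (2 * (1 / 4))))))) by field.
    rewrite /e -!expRD; apply: ler_wpM2l; first lra.
    apply: ler_wpM2l; first lra.
    rewrite ler_expR (_ : x = y + b); last by rewrite /y; ring.
    rewrite (_ : 2 * (1 / 4) = 1 / 2); last by field.
    have -> : y ^+ 2 / (1 / 2) = 2 * y ^+ 2 by field.
    have : 0 <= (3 * y - 2) ^+ 2 by exact: sqr_ge0.
    nra.
  set y := x - b * n.+2%:R.
  have y0 : 0 <= y by rewrite subr_ge0.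
  have n1 : 1 <= n.+1%:R :> R by rewrite ler1n.
  have t0 : 0 < t n.+1 by rewrite /t; lra.
  have rr := r1 n.+1 isT.
  have rV : 0 < (r n.+1)^-1 by rewrite invr_gt0; lra.
  have rV1 : (r n.+1)^-1 <= 1 by rewrite invf_le1//; lra.
  have B0 : 0 <= B n.+1 by rewrite mulr_ge0 ?addr_ge0// ?(ltW A0)// ltW.
  have B2 : B n.+1 <= 2 * A by rewrite /B; nra.
  have := @one_sub_Fr_step n.+1 x (B n.+1) (t n.+1) t0 B0 IH.
  rewrite /= -/y => /(_ y0); set q := B n.+1 * _ => hq.
  apply: le_trans hq.
  have tE : t n.+1 + 1 = t n.+2 by rewrite /t -[n.+2%:R]natr1; ring.
  rewrite tE in q *.
  set w := expR (- b * y) * heat (t n.+2) y in q *.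
  have qE : q = B n.+1 * w by [].
  have tn : n.+1%:R <= t n.+2 by rewrite /t -[n.+2%:R]natr1; lra.
  have t20 : 0 < t n.+2 by lra.
  have sn : r n.+1 <= Num.sqrt (t n.+2) by rewrite ler_sqrt// ltW.
  have w0 : 0 <= w.
    by rewrite /w /heat !mulr_ge0 ?expR_ge0 ?invr_ge0 ?mulr_ge0 ?sqrtr_ge0// ltW.
  have wU : w <= b^-1 * (r n.+1 ^+ 3)^-1.
    rewrite /w /heat.
    have -> : expR (- b * y) * (y * expR (- (y ^+ 2 / (2 * t n.+2))) / (t n.+2 * Num.sqrt (t n.+2))) =
      (y * expR (- b * y)) * (expR (- (y ^+ 2 / (2 * t n.+2))) / (t n.+2 * Num.sqrt (t n.+2))).
      by ring.
    apply: ler_pM.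
    - by rewrite mulr_ge0 ?expR_ge0.
    - by rewrite divr_ge0 ?expR_ge0// mulr_ge0 ?sqrtr_ge0// ltW.
    - exact: mul_expRN_le.
    rewrite -[leRHS]mul1r; apply: ler_pM.
    - exact: expR_ge0.
    - by rewrite invr_ge0 mulr_ge0 ?sqrtr_ge0// ltW.
    - by rewrite expR_le1 oppr_le0 divr_ge0 ?sqr_ge0// mulr_ge0// ltW.
    have p1 : 0 < t n.+2 * Num.sqrt (t n.+2) by rewrite mulr_gt0// sqrtr_gt0.
    have p2 : 0 < r n.+1 ^+ 3 by rewrite exprn_gt0//; lra.
    rewrite lef_pV2 ?posrE//.
    rewrite exprSr r2; apply: ler_pM => //; lra.
  have rE : r n.+2 ^+ 2 = r n.+1 ^+ 2 + 1 by rewrite !r2 -[n.+2%:R]natr1.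
  have /= [_ _ _ h3 _] := front_step_size b0 rr (r0 n.+2) rE.
  set u := (r n.+1 ^+ 3)^-1 in wU h3.
  rewrite qE.
  have -> : B n.+1 * w - (B n.+1 * w) ^+ 2 = (B n.+1 * (1 - B n.+1 * w)) * w by ring.
  apply: ler_wpM2r => //.
  have u0 : 0 <= u by rewrite invr_ge0 exprn_ge0.
  have k1 : B n.+1 * (B n.+1 * w) <= 4 * A ^+ 2 * (b^-1 * u).
    rewrite mulrA; apply: ler_pM => //; first by rewrite mulr_ge0.
    nra.
  have k2 : 4 * A ^+ 2 * (b^-1 * u) <= A * u / 6.
    have : 24 * A * b^-1 <= 1 by rewrite ler_pdivrMr// mul1r; lra.
    have : 0 <= A * u by rewrite mulr_ge0// ltW.
    nra.
  rewrite mulrBr mulr1 /B in k1 *; nra.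
exists (A * expR (- b - 2)); first by rewrite mulr_gt0 ?expR_gt0.
move=> n n1; apply: le_trans (main n n1 (b * n%:R + 1) _); last by lra.
rewrite (_ : b * n%:R + 1 - b * n%:R = 1); last ring.
have nr : 1 <= n%:R :> R by rewrite ler1n.
have t0 : 1 / 4 <= t n by rewrite /t; lra.
have tn : t n <= n%:R by rewrite /t; lra.
have st : 0 < Num.sqrt (t n) by rewrite sqrtr_gt0; lra.
rewrite /heat mulr1 mul1r expr1n mul1r.
rewrite -mulrA; apply: ler_pM.
- exact: ltW.
- by rewrite mulr_ge0 ?expR_ge0// invr_ge0 mulr_ge0 ?sqrtr_ge0.
- by rewrite /B ler_peMr ?(ltW A0)// lerDl invr_ge0.
rewrite expRD -mulrA; apply: ler_wpM2l; first exact: expR_ge0.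
apply: ler_pM; rewrite ?expR_ge0 ?invr_ge0 ?mulr_ge0 ?sqrtr_ge0//.
- rewrite ler_expR lerN2 invf_ple ?posrE//; lra.
- have p1 : 0 < n%:R * Num.sqrt n%:R :> R by rewrite mulr_gt0 ?sqrtr_gt0//; lra.
  have p2 : 0 < t n * Num.sqrt (t n) by rewrite mulr_gt0//; lra.
  rewrite lef_pV2 ?posrE//.
  by apply: ler_pM; rewrite ?sqrtr_ge0 ?ler_sqrt//; lra.
Qed.

End subsolution.

(** * From a gap of order n^(-3/2) to a polynomially small lower tail *)

Lemma expR_ge_sqr_half (R : realType) (x : R) : 0 <= x -> 1 + x ^+ 2 / 2 <= expR x.
Proof. by move=> x0; exact: (expR_ge1Dxn 1 x0). Qed.

Lemma ln_nat_ge (R : realType) (l : R) : exists N : nat, forall n : nat, (N <= n)%N ->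
  l <= ln n%:R.
Proof.
exists (Num.truncn (expR l)).+1 => n Nn.
have h : expR l <= n%:R.
  have /andP[_ h] := truncn_itv (expR_ge0 l).
  by rewrite (le_trans (ltW h))// ler_nat.
rewrite -[leLHS](expRK l) ler_ln ?posrE ?expR_gt0//.
exact: lt_le_trans (expR_gt0 _) h.
Qed.

Lemma natr_ceil (R : realType) (x : R) : 0 <= x -> exists j : nat, x <= j%:R <= x + 1 /\ (1 <= j)%N.
Proof.
move=> x0; exists (Num.truncn x).+1; have /andP[h1 h2] := truncn_itv x0.
by split => //; rewrite (ltW h2) -natr1 lerD2r.
Qed.

Lemma expR_add_le (R : realType) (u v : R) : 1 <= v ->
  expR (- (u + v)) + expR (- (u + v)) <= expR (- u).
Proof.
move=> v1; rewrite (_ : - u = v + - (u + v)); last by ring.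
rewrite [leRHS]expRD; have := expR_ge1Dx v; have := expR_gt0 (- (u + v)).
set e := expR (- _) => e0 h.
have : (1 + v) * e <= expR v * e by rewrite ler_pM2r.
have : 1 * e <= v * e by rewrite ler_pM2r.
lra.
Qed.

(** The surplus 8/5 - 3/2 leaves [c * expR (L / 10)], whose quadratic term exceeds [L] as soon as
    [L >= 200 / c]. *)
Lemma mul_expR_ge (R : realType) (c L M : R) : 0 < c -> 0 <= L -> 200 / c <= L ->
  expR (8 / 5 * L) <= M -> L <= M * (c * expR (- (3 / 2 * L))).
Proof.
move=> c0 L0 L3 hM.
apply: (@le_trans _ _ (expR (8 / 5 * L) * (c * expR (- (3 / 2 * L))))); last first.
  by rewrite ler_wpM2r// mulr_ge0 ?expR_ge0// ltW.
rewrite mulrCA -expRD (_ : 8 / 5 * L + - (3 / 2 * L) = L / 10); last by field.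
have h : 1 + (L / 10) ^+ 2 / 2 <= expR (L / 10) by apply: expR_ge_sqr_half; rewrite divr_ge0.
have h1 : L * 200 <= L * (L * c) by rewrite ler_wpM2l// -ler_pdivrMr.
have : c * (1 + (L / 10) ^+ 2 / 2) <= c * expR (L / 10) by rewrite ler_wpM2l// ltW.
lra.
Qed.

Section lower_tail.
Context {R : realType}.
Variable d : nat.
Hypothesis hd : (2 <= d)%N.
Local Notation b := (@speed R d).
Local Notation F := (@Fr R d).

(** Jensen's inequality, by averaging the tangent to the power at the mean. *)
Lemma gmean_pow_le (f : R -> R) (n : nat) : measurable_fun setT f ->
  (forall s, 0 <= f s <= 1) -> (gmean f) ^+ n <= gmean (fun s => f s ^+ n).
Proof.
move=> mf f01.
have gp k : gint (fun s => f s ^+ k).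
  apply: (@gint_bounded _ _ 1); first exact: measurable_funX.
  by move=> s; have /andP[h0 h1] := f01 s; rewrite ger0_norm ?exprn_ge0// exprn_ile1.
have gf : gint f by exact: (gp 1%N).
set p := gmean f.
have p0 : 0 <= p by apply: gmean_ge0 => s; case/andP: (f01 s).
case: n => [|n]; first by rewrite expr0 (eq_gmean (fun s => expr0 (f s))) gmean_cst.
have tangent (y : R) : 0 <= y -> p ^+ n.+1 + n.+1%:R * p ^+ n * (y - p) <= y ^+ n.+1.
  move=> y0; elim: n => [|n IH]; first by rewrite !expr1 expr0; lra.
  rewrite [leRHS]exprS; apply: (le_trans _ (ler_wpM2l y0 IH)).
  rewrite -subr_ge0 (_ : _ - _ = n.+1%:R * p ^+ n * (y - p) ^+ 2).
    by apply: mulr_ge0; [apply: mulr_ge0 => //; exact: exprn_ge0|exact: sqr_ge0].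
  by rewrite -[n.+2%:R]natr1 !exprS; ring.
have -> : p ^+ n.+1 = gmean (fun s => p ^+ n.+1 + n.+1%:R * p ^+ n * (f s - p)).
  rewrite gmeanD ?gmean_cst ?gmeanZ ?gmeanB ?gmean_cst//; try exact: gint_cst.
  - by rewrite subrr mulr0 addr0.
  - by apply: gintB => //; exact: gint_cst.
  - by apply: gintZ; apply: gintB => //; exact: gint_cst.
apply: gmean_le => //.
  apply: gintD; first exact: gint_cst.
  by apply: gintZ; apply: gintB => //; exact: gint_cst.
by move=> s; apply: tangent; case/andP: (f01 s).
Qed.

(* Jensen for the power [M] replaces the product over the [d ^ j] subtrees by the
   [d ^ j]-th power of a single one, seen from a Gaussian point of variance [j]. *)
Lemma Fr_pow_le k c l j M x : 0 <= l -> (1 <= M)%N ->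
  F (k + j)%N x ^+ M <= F k c ^+ (M * d ^ j) + expR (l * (x - c) + j%:R * l ^+ 2 / 2).
Proof.
move=> l0; elim: j M x => [|j IH] M x M1.
  rewrite addn0 expn0 muln1 mul0r mul0r addr0.
  have [xc|xc] := leP x c.
    apply: ler_wpDr; first exact: expR_ge0.
    by rewrite lerXn2r ?nnegrE ?Fr_ge0 ?Fr_homo.
  apply: ler_wpDl; first by rewrite exprn_ge0 ?Fr_ge0.
  apply: (@le_trans _ _ 1); first by rewrite exprn_ile1 ?Fr_ge0 ?Fr_le1.
  by apply: one_le_expR; rewrite mulr_ge0//; lra.
rewrite addnS /= -exprM.
apply: (le_trans (gmean_pow_le (d * M) _ _)).
- exact: measurable_shift (measurable_Fr d _).
- by move=> s; rewrite Fr_ge0 Fr_le1.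
set q := F k c ^+ _.
pose e := expR (l * (x - c) + j%:R * l ^+ 2 / 2).
have dM : (1 <= d * M)%N by rewrite muln_gt0; lia.
have gl := @gint_exp R l.
apply: (@le_trans _ _ (gmean (fun s => q + e * expR (l * s)))).
  apply: gmean_le.
  - apply: (@gint_bounded _ _ 1).
      by apply: measurable_funX; exact: measurable_shift (measurable_Fr d _).
    by move=> s; rewrite ger0_norm ?exprn_ge0 ?exprn_ile1 ?Fr_ge0 ?Fr_le1.
  - by apply: gintD; [exact: gint_cst|exact: gintZ].
  - move=> s; have := IH (d * M)%N (x + s) dM.
    rewrite /q /e -expRD (_ : (d * M * d ^ j = M * d ^ j.+1)%N); last by rewrite expnS; lia.
    rewrite (_ : l * (x - c) + j%:R * l ^+ 2 / 2 + l * s = l * (x + s - c) + j%:R * l ^+ 2 / 2)//.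
    by ring.
rewrite gmeanD ?gmean_cst ?gmeanZ//; [|exact: gint_cst|exact: gintZ].
rewrite gmean_exp /e -expRD lerD2l ler_expR -natr1.
by rewrite le_eqVlt; apply/orP; left; apply/eqP; field.
Qed.

(** The choice [l = a / j] minimises [- l * a + j * l ^+ 2 / 2]. *)
Lemma Fr_boost k j a x : (1 <= j)%N -> 0 <= a ->
  F (k + j)%N x <= F k (x + a) ^+ (d ^ j) + expR (- (a ^+ 2 / (2 * j%:R))).
Proof.
move=> j1 a0; have jp : 0 < j%:R :> R by rewrite ltr0n.
have l0 : 0 <= a / j%:R by rewrite divr_ge0.
have := @Fr_pow_le k (x + a) (a / j%:R) j 1 x l0 isT.
rewrite expr1 mul1n => /le_trans; apply; rewrite lerD2l ler_expR.
by rewrite le_eqVlt; apply/orP; left; apply/eqP; field; rewrite gt_eqF.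
Qed.

(* About [8/5 log_d n] levels make the probability [c n^(-3/2)] of failure of a subtree
   certain enough for a first small bound, which 15 further levels make polynomial:
   [2 ^ 15 >= 3 * 64 * 100]. *)
Lemma Fr_tail_small (c L x : R) (k j : nat) : 0 < c -> (1 <= k)%N -> (1 <= j)%N ->
  c / (k%:R * Num.sqrt k%:R) <= 1 - F k (b * k%:R + 1) -> k%:R <= expR L ->
  64 * 100 <= L -> 200 / c <= L -> 8 / 5 * L <= j%:R * ln d%:R -> j%:R <= 4 * (L / b ^+ 2) ->
  x + L / (20 * b) <= b * k%:R + 1 ->
  F (k + j)%N x <= expR (- (L / (64 * 100))).
Proof.
move=> c0 k1 j1 Hc kL L1 L3 jl ju hx.
have b0 := @speed_gt0 R d hd; have D2 := @branching_ge2 R d hd.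
have L0 : 0 <= L by clear -L1; lra.
pose a := L / (20 * b).
have a0 : 0 <= a by rewrite divr_ge0// mulr_ge0// ltW.
apply: (le_trans (@Fr_boost k j a x j1 a0)).
have h1 : F k (x + a) <= expR (- (c * expR (- (3 / 2 * L)))).
  apply: (le_trans (@Fr_homo R d k _ _ hx)).
  have kp : 0 < k%:R :> R by rewrite ltr0n.
  have E : expR (- (3 / 2 * L)) = (expR L * Num.sqrt (expR L))^-1.
    by rewrite expRN; congr (_^-1); rewrite -(expR_half_ln (expR_gt0 L)) expRK -expRD; congr expR; by field.
  have : c * expR (- (3 / 2 * L)) <= c / (k%:R * Num.sqrt k%:R).
    rewrite ler_pM2l// E lef_pV2 ?posrE ?mulr_gt0 ?sqrtr_gt0 ?expR_gt0//.
    by apply: ler_pM => //; rewrite ler_sqrt// expR_gt0.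
  have := expR_ge1Dx (- (c * expR (- (3 / 2 * L)))).
  by clear -Hc; lra.
have h2 : F k (x + a) ^+ (d ^ j) <= expR (- L).
  apply: (@le_trans _ _ (expR (- (c * expR (- (3 / 2 * L)))) ^+ (d ^ j))).
    by rewrite lerXn2r ?nnegrE ?Fr_ge0 ?expR_ge0.
  rewrite -expRM_natl ler_expR mulrN lerN2; apply: mul_expR_ge => //.
  have Dp : 0 < d%:R :> R by clear -D2; lra.
  have -> : (d ^ j)%:R = expR (j%:R * ln d%:R) :> R by rewrite natrX expRM_natl lnK.
  by rewrite ler_expR.
(* With [a = L / (20 * b)] and [j] at most [4 * (L / b ^+ 2)] the exponent is at least [L / 3200];
   halving it absorbs the sum of two terms. *)
have h3 : expR (- (a ^+ 2 / (2 * j%:R))) <= expR (- (L / (32 * 100))).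
  rewrite ler_expR lerN2 ler_pdivlMr; last by rewrite mulr_gt0// ltr0n.
  have -> : a ^+ 2 = L * (L / b ^+ 2) / 400 by rewrite /a; field; rewrite gt_eqF.
  have : L * j%:R <= L * (4 * (L / b ^+ 2)) by rewrite ler_wpM2l.
  by clear -b0; lra.
have L1' : 1 <= L / (64 * 100) by clear -L1; lra.
apply: le_trans (expR_add_le (L / (64 * 100)) L1').
rewrite (_ : L / (64 * 100) + L / (64 * 100) = L / (32 * 100)); last by clear -b0; field.
apply: lerD h3; apply: (le_trans h2); rewrite ler_expR lerN2.
by clear -L0; lra.
Qed.

(** With the number of levels fixed, a shift of order [L] has Gaussian cost
    [L ^+ 2 / (12000 * b ^+ 2)], which exceeds [3 * L] for large [L], while the power [d ^ 15]
    multiplies the exponent already gained. *)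
Lemma Fr_tail_amplify (L x : R) (k : nat) : 1 <= L -> 36 * 1000 * b ^+ 2 <= L ->
  F k (x + L / (20 * b)) <= expR (- (L / (64 * 100))) ->
  F (k + 15)%N x <= expR (- (2 * L)).
Proof.
move=> L1 L2 hF.
have b0 := @speed_gt0 R d hd; have D2 := @branching_ge2 R d hd.
have b2 : 0 < b ^+ 2 by rewrite exprn_gt0.
have L0 : 0 <= L by clear -L1; lra.
pose a := L / (20 * b).
have a0 : 0 <= a by rewrite divr_ge0// mulr_ge0// ltW.
apply: (le_trans (@Fr_boost k 15 a x isT a0)).
apply: le_trans (expR_add_le (2 * L) L1).
rewrite (_ : 2 * L + L = 3 * L); last by clear -b0; ring.
apply: lerD.
  apply: (@le_trans _ _ (expR (- (L / (64 * 100))) ^+ (d ^ 15))).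
    by rewrite lerXn2r ?nnegrE ?Fr_ge0 ?expR_ge0.
  rewrite -expRM_natl ler_expR mulrN lerN2.
  have h : (2 ^ 15)%:R <= (d ^ 15)%:R :> R by rewrite ler_nat leq_exp2r.
  rewrite (_ : 3 * L = 64 * 100 * 3 * (L / (64 * 100))); last by clear -b0; field.
  rewrite ler_wpM2r//; first by rewrite divr_ge0// -natrM.
  by apply: le_trans h; rewrite natrX; clear -b0; lra.
rewrite ler_expR lerN2.
have -> : a ^+ 2 / (2 * 15) = L * (L / b ^+ 2) / (12 * 1000) by rewrite /a; field; rewrite gt_eqF.
have h3 : 36 * 1000 <= L / b ^+ 2 by rewrite ler_pdivlMr.
have : L * (36 * 1000) <= L * (L / b ^+ 2) by rewrite ler_wpM2l.
by clear -b0; lra.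
Qed.

(** In 17/5 = 16/5 + 2/20 + 1/10, the first term is the speed times [8 / 5 * L / ln d] levels, the
    second the two shifts [L / (20 * b)], the third absorbs bounded terms. The logarithm is that of
    [n] since [k] will be the height of a subtree of the tree of height [n]. *)
Lemma Fr_lower_tail : exists N : nat, forall n k : nat, (N <= n)%N -> (n <= 2 * k)%N -> (k <= n)%N ->
  F k (b * k%:R - 17 / 5 * ln n%:R / b + b) <= expR (- (2 * ln n%:R)).
Proof.
have b0 := @speed_gt0 R d hd; have bb := @speed_sqr R d hd.
have lD := @ln_branching_gt0 R d hd.
have [c c0 Hc] := @one_sub_Fr_speed_ge R d hd.
have [N1 HN1] := @ln_nat_ge R (64 * 100).
have [N2 HN2] := @ln_nat_ge R (36 * 1000 * b ^+ 2).
have [N3 HN3] := @ln_nat_ge R (200 / c).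
have [N4 HN4] := @ln_nat_ge R (26 / b ^+ 2).
exists (N1 + N2 + N3 + N4).+1 => n k Nn nk kn.
have [n1 n2 n3 [n4 np]] : [/\ (N1 <= n)%N, (N2 <= n)%N, (N3 <= n)%N & (N4 <= n)%N /\ (0 < n)%N].
  by clear -Nn; split; [| | |split]; lia.
have L1 := HN1 n n1; have L2 := HN2 n n2; have L3 := HN3 n n3; have L4 := HN4 n n4.
set L := ln n%:R in L1 L2 L3 L4 *.
have b2 : 0 < b ^+ 2 by rewrite exprn_gt0.
have eL : expR L = n%:R by rewrite lnK// posrE ltr0n.
have L0 : 0 <= L by clear -L1; lra.
have L11 : 1 <= L by clear -L1; lra.
have Lb2 : 36 * 1000 <= L / b ^+ 2 by rewrite ler_pdivlMr.
have [|j [/andP[jl ju] j1]] := @natr_ceil R (8 / 5 * L / ln d%:R).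
  by rewrite divr_ge0 ?(ltW lD)// mulr_ge0// divr_ge0.
have {}jl : 8 / 5 * L <= j%:R * ln d%:R by rewrite -ler_pdivrMr.
have {}ju : j%:R <= 16 / 5 * (L / b ^+ 2) + 1.
  apply: (le_trans ju); rewrite lerD2r (_ : ln d%:R = b ^+ 2 / 2); last by rewrite bb; field.
  by rewrite le_eqVlt; apply/orP; left; apply/eqP; field; rewrite gt_eqF.
have hk : (15 + j < k)%N.
  rewrite -(ltr_nat R) natrD.
  have kL : 1 / 2 * expR L <= k%:R.
    rewrite eL; have : n%:R <= (2 * k)%:R :> R by rewrite ler_nat.
    by rewrite natrM; clear -b0; lra.
  have q1 : L / b ^+ 2 <= L ^+ 2 / 26.
    rewrite (_ : L / b ^+ 2 = L * (26 / b ^+ 2) / 26); last by clear -b0; field; rewrite gt_eqF.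
    by rewrite ler_pM2r ?invr_gt0// expr2 ler_wpM2l.
  have q2 : L * (64 * 100) <= L ^+ 2 by rewrite expr2 ler_wpM2l.
  by have := @expR_ge_sqr_half R L L0; clear -kL q1 q2 ju L1; lra.
have [k' [kE k'1 k'n]] : exists k', [/\ k = (k' + j + 15)%N, (1 <= k')%N & (k' <= n)%N].
  by clear -hk kn; exists (k - 15 - j)%N; split; lia.
have kr : k%:R = k'%:R + j%:R + 15 :> R by rewrite {1}kE !natrD.
rewrite {1}kE; apply: Fr_tail_amplify => //.
apply: (@Fr_tail_small c) => //; [exact: Hc|by rewrite eL ler_nat|by clear -ju Lb2; lra|].
have h1 : b * j%:R <= 16 / 5 * (L / b) + b.
  apply: (le_trans (ler_wpM2l (ltW b0) ju)).
  by rewrite le_eqVlt; apply/orP; left; apply/eqP; clear -b0; field; rewrite gt_eqF.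
have h2 : 170 * b <= L / b.
  have b1 : 0 <= b ^+ 2 by exact: ltW.
  by rewrite ler_pdivlMr// -mulrA -expr2; clear -L2 b1; lra.
have -> : L / (20 * b) = L / b / 20 by clear -b0; field; rewrite gt_eqF.
rewrite kr -(mulrA (17 / 5)); set Q := L / b in h1 h2 *.
by clear -h1 h2 b0; lra.
Qed.

End lower_tail.

(** * The probability of the wall *)

Section wall_prob.
Context {R : realType}.
Variable d : nat.
Hypothesis hd : (2 <= d)%N.
Local Notation b := (@speed R d).
Local Notation F := (@Fr R d).
Local Notation D := (d%:R : R).

(* The number of levels after which the tree has about [m] vertices. *)
Lemma level_of_size (m : nat) : (1 < m)%N -> exists2 l : nat, (0 < l)%N &
  (m <= d ^ l)%N /\ (d ^ l < d * m)%N.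
Proof.
move=> m1; have d1 : (1 < d)%N by [].
have l0 : (0 < up_log d m)%N by rewrite up_log_gt0// d1.
exists (up_log d m) => //.
have /andP[h1 h2] := up_log_bounds d1 m1; split => //.
by rewrite -(prednK l0) expnS ltn_pmul2l//; lia.
Qed.

Lemma level_bounds (m l : nat) : (0 < m)%N -> (m <= d ^ l)%N -> (d ^ l < d * m)%N ->
  ln m%:R <= l%:R * ln D :> R /\ l%:R * ln D <= ln m%:R + ln D.
Proof.
move=> m0 h1 h2.
have D2 := @branching_ge2 R d hd.
have mp : 0 < m%:R :> R by rewrite ltr0n.
have Dp : 0 < D by lra.
have E : l%:R * ln D = ln ((d ^ l)%:R) by rewrite natrX lnXn// mulr_natl.
rewrite E; split.
  by rewrite ler_ln ?posrE ?ltr0n ?expn_gt0 ?ler_nat//; lia.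
rewrite -lnM ?posrE// ler_ln ?posrE ?mulr_gt0//; last by rewrite ltr0n expn_gt0; lia.
by rewrite mulrC -natrM ler_nat ltnW.
Qed.

(** Let each child step into [[h, h + 1 / (1 + h)]]. Over so short an interval the exponent
    [s ^+ 2 / 2] grows by at most 3/2, and the length costs only [ln (1 + h)]. *)
Lemma Fr_lift_step m (y h L : R) : 0 <= h -> expR (- L) <= F m (y + h) ->
  expR (- (D * (L + h ^+ 2 / 2 + ln (1 + h) + (3 / 2 - ln gpeak)))) <= F m.+1 y.
Proof.
move=> h0 HL; have gp := @gpeak_gt0 R.
rewrite -mulrN expRM_natl /= lerXn2r ?nnegrE ?expR_ge0 ?gmean_Fr_ge0//.
pose w := (1 + h)^-1.
have h1 : 0 < 1 + h by lra.
have w0 : 0 < w by rewrite invr_gt0.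
have hw : w * (1 + h) = 1 by rewrite mulVf// gt_eqF.
have := @gmean_indic_ge R h (h + w) (h + w) (F m (y + h)) (fun s => F m (y + s)).
rewrite (_ : h + w - h = w); last ring.
move=> H; apply: le_trans (H _ _ _ _ _ _ _).
- have -> : - (L + h ^+ 2 / 2 + ln (1 + h) + (3 / 2 - ln gpeak)) =
    - L + (ln gpeak + (- ln (1 + h) + (- (h ^+ 2 / 2) - 3 / 2))) by ring.
  rewrite expRD; apply: ler_pM; rewrite ?expR_ge0//.
  rewrite expRD lnK// mulrCA; apply: ler_wpM2l; first exact: ltW.
  rewrite expRD expRN lnK//; apply: ler_wpM2l; first exact: ltW.
  by rewrite ler_expR; nra.
- by rewrite lerDl ltW.
- by rewrite ger0_norm// lerDl ltW.
- by rewrite ger0_norm// addr_ge0// ltW.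
- exact: Fr_ge0.
- exact: gint_Fr.
- by move=> s; exact: Fr_ge0.
- by move=> s /andP[hs _]; apply: Fr_homo; rewrite lerD2l.
Qed.

(* The shifts [e d^r] minimise the Gaussian cost of lifting all leaves by their sum. *)
Lemma Fr_lift k (x e c : R) r : 0 <= e -> 0 <= c -> e <= c -> 3 / 2 - ln gpeak <= c ->
  expR (- 1) <= F k x ->
  expR (- (D ^+ r * (1 + 4 * c + 2 * ln D) - (2 * ln D * r%:R + (4 * c + 2 * ln D)) +
     e ^+ 2 * D ^+ r * (D ^+ r - 1) / (2 * (D - 1)))) <=
  F (k + r)%N (x - e * ((D ^+ r - 1) / (D - 1))).
Proof.
move=> e0 c0 ec gc H.
have D2 := @branching_ge2 R d hd; have lD := @ln_branching_gt0 R d hd.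
have D1 : D - 1 != 0 by rewrite gt_eqF; lra.
elim: r => [|r IH].
  rewrite addn0 expr0 subrr mul0r !mulr0 mul0r addr0 subr0 mul1r add0r.
  by rewrite (_ : - _ = - 1) //; ring.
have Dr1 : 1 <= D ^+ r by rewrite exprn_ege1//; lra.
have h0 : 0 <= e * D ^+ r by rewrite mulr_ge0//; lra.
rewrite addnS.
set y := x - _.
have yE : y + e * D ^+ r = x - e * ((D ^+ r - 1) / (D - 1)).
  by rewrite /y exprS; field.
rewrite -yE in IH.
apply: (le_trans _ (Fr_lift_step h0 IH)).
rewrite ler_expR lerN2.
have lnb : ln (1 + e * D ^+ r) <= e + r%:R * ln D.
  apply: (@le_trans _ _ (ln ((1 + e) * D ^+ r))).
    by rewrite ler_ln ?posrE ?mulr_gt0 ?exprn_gt0//; nra.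
  rewrite lnM ?posrE ?exprn_gt0//; try lra.
  rewrite lnXn; last lra.
  by rewrite mulr_natl lerD2r le_ln1Dx//; lra.
have hr : 0 <= r%:R * ln D by rewrite mulr_ge0// ltW.
(* The costs [ln (1 + e * D ^+ r)] grow linearly in [r]; the subtracted linear term of the statement
   is there to absorb them, using [2 <= D]. *)
set A := 1 + 4 * c + 2 * ln D; set lr := r%:R * ln D in lnb hr.
have -> : e ^+ 2 * D ^+ r.+1 * (D ^+ r.+1 - 1) / (2 * (D - 1)) =
    D * (e ^+ 2 * D ^+ r * (D ^+ r - 1) / (2 * (D - 1)) + (e * D ^+ r) ^+ 2 / 2).
  by rewrite (exprS D r); field.
set q := e ^+ 2 * _ * _ / _.
apply: (@le_trans _ _ (D * (D ^+ r * A - (2 * ln D * r%:R + (4 * c + 2 * ln D)) + q +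
  (e * D ^+ r) ^+ 2 / 2 + (lr + 2 * c)))).
  by rewrite ler_wpM2l//; lra.
rewrite (exprS D r) -[r.+1%:R]natr1.
have -> : 2 * ln D * r%:R = 2 * lr by rewrite /lr; ring.
have -> : 2 * ln D * (r%:R + 1) = 2 * lr + 2 * ln D by rewrite /lr; ring.
have : 0 <= (D - 2) * (lr + 2 * c + 2 * ln D) by rewrite mulr_ge0//; lra.
lra.
Qed.

Lemma half_levels (m n l : nat) : (0 < l)%N -> (m <= d ^ l)%N -> (d ^ l < d * m)%N -> (0 < m)%N ->
  2 * (ln m%:R / ln D + 1) <= n%:R :> R -> (2 * l <= n)%N.
Proof.
move=> l0 h1 h2 m0 h; have lD := @ln_branching_gt0 R d hd.
have [_ h3] := level_bounds m0 h1 h2.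
rewrite -(ler_nat R) natrM; apply: le_trans h; rewrite ler_pM2l// -(ler_pM2r lD).
by rewrite mulrDl divfK ?gt_eqF// mul1r.
Qed.

(** Giving up [l] levels lowers the front by [b * l >= 2 * ln n / b], whence 7/2 = 3/2 + 2; the
    constant [3 / (2 * b)] covers [ln n - ln k <= 1]. *)
Lemma mean_max_levels (n k l : nat) (C0 : R) : (n = k + l)%N -> (0 < n)%N -> (n <= 2 * k)%N ->
  2 * (ln n%:R : R) <= l%:R * b ^+ 2 ->
  mean_max R d k + C0 <= b * n%:R - 7 / 2 * ln n%:R / b + (C0 + 3 / (2 * b)).
Proof.
move=> nE n0 nk hl; have b0 := @speed_gt0 R d hd.
have np : 0 < n%:R :> R by rewrite ltr0n.
have k0 : (0 < k)%N by clear -n0 nk; lia.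
have kp : 0 < k%:R :> R by rewrite ltr0n.
have lnk : ln n%:R <= 1 + ln k%:R :> R.
  rewrite -[X in X + _](expRK 1) -lnM ?posrE ?expR_gt0// ler_ln ?posrE ?mulr_gt0 ?expR_gt0//.
  apply: (@le_trans _ _ (2 * k%:R)); first by rewrite -natrM ler_nat.
  by rewrite ler_pM2r//; have := expR_ge1Dx (1 : R); lra.
have hbl : 2 * ln n%:R / b <= b * l%:R by rewrite ler_pdivrMr//; lra.
have bn : b * n%:R = b * k%:R + b * l%:R by rewrite nE natrD mulrDr.
rewrite mean_maxE.
have := ler_wpM2l (_ : 0 <= 3 / (2 * b)) lnk; rewrite divr_ge0 ?mulr_ge0 ?(ltW b0)// => /(_ isT).
have -> : 7 / 2 * ln n%:R / b = 2 * ln n%:R / b + 3 / (2 * b) * ln n%:R.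
  by field; rewrite gt_eqF.
lra.
Qed.

(** The excess over the ideal cost is linear in [N]: replacing [X] by [X + C1] adds a multiple of
    [X], and [T / (T - 1)] differs from 1 by at most [2 / N] while [H ^+ 2] has order [N ^+ 2]. *)
Lemma lift_cost_le (X H C1 T N : R) : 0 <= X -> 0 <= C1 -> H = X + C1 -> X <= b * N -> 2 <= N -> N <= T ->
  H ^+ 2 * (D - 1) * T / (2 * (T - 1)) <=
  (D - 1) / 2 * X ^+ 2 + (D - 1) / 2 * (2 * b * C1 + C1 ^+ 2 + 2 * (b + C1) ^+ 2) * N.
Proof.
move=> X0 C10 HE XN N2 NT; have b0 := @speed_gt0 R d hd; have D2 := @branching_ge2 R d hd.
have TN : T / (T - 1) <= 1 + 2 / N.
  rewrite ler_pdivrMr; last lra.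
  rewrite -subr_ge0 (_ : _ - _ = (2 * T - 2 - N) / N); last by field; rewrite gt_eqF//; lra.
  by rewrite divr_ge0//; lra.
have H0 : 0 <= H by lra.
have HN : H <= (b + C1) * N by nra.
have bC : 0 <= b + C1 by lra.
have h2 : H ^+ 2 * (2 / N) <= 2 * (b + C1) ^+ 2 * N.
  rewrite mulrA ler_pdivrMr; last lra.
  have : H ^+ 2 <= ((b + C1) * N) ^+ 2 by rewrite lerXn2r ?nnegrE// mulr_ge0//; lra.
  by lra.
have h1 : H ^+ 2 <= X ^+ 2 + (2 * b * C1 + C1 ^+ 2) * N.
  have : C1 * X <= C1 * (b * N) by rewrite ler_wpM2l.
  have : C1 ^+ 2 <= C1 ^+ 2 * N by rewrite ler_peMr ?sqr_ge0//; lra.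
  rewrite HE; lra.
have -> : H ^+ 2 * (D - 1) * T / (2 * (T - 1)) = (D - 1) / 2 * (H ^+ 2 * (T / (T - 1))).
  by field; rewrite gt_eqF//; lra.
have D10 : 0 <= (D - 1) / 2 by lra.
have : H ^+ 2 * (T / (T - 1)) <= H ^+ 2 * (1 + 2 / N) by rewrite ler_wpM2l ?sqr_ge0.
rewrite mulrDr mulr1 => h3.
rewrite -(mulrA ((D - 1) / 2) (2 * b * C1 + _ + _)) -mulrDr ler_wpM2l//; lra.
Qed.

Lemma wall_prob_ge : exists C : R, exists N : nat, 0 <= C /\ forall n : nat, (N <= n)%N ->
  expR (- ((D - 1) / 2 * (b * n%:R - 7 / 2 * ln n%:R / b) ^+ 2 + C * n%:R)) <= F n 0.
Proof.
have b0 := @speed_gt0 R d hd; have D2 := @branching_ge2 R d hd.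
have lD := @ln_branching_gt0 R d hd; have bb := @speed_sqr R d hd.
have [C0 C00 HC0] := @Fr_mean_max_ge_half R d hd.
pose C1 := C0 + 3 / (2 * b).
have C10 : 0 <= C1 by rewrite addr_ge0// divr_ge0// mulr_ge0// ltW.
pose E := 2 * (D - 1) * (b + C1).
have E0 : 0 <= E by rewrite !mulr_ge0//; lra.
pose c := E + `|3 / 2 - ln gpeak|.
have c0 : 0 <= c by rewrite addr_ge0.
have Ec : E <= c by rewrite lerDl.
have gc : 3 / 2 - ln gpeak <= c by rewrite (le_trans (ler_norm _))// lerDr.
pose A := 1 + 4 * c + 2 * ln D.
have A0 : 0 <= A by rewrite /A; lra.
pose C := D * A + (D - 1) / 2 * (2 * b * C1 + C1 ^+ 2 + 2 * (b + C1) ^+ 2).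
pose L0 := 4 + 4 / ln D + 7 / b ^+ 2.
have [N HN] := @ln_nat_ge R L0.
exists C, N.+2; split.
  have q1 : 0 <= 2 * b * C1 by rewrite !mulr_ge0// ltW.
  have q2 := sqr_ge0 C1; have q3 := sqr_ge0 (b + C1).
  by apply: addr_ge0; apply: mulr_ge0; lra.
move=> n Nn.
have n1 : (1 < n)%N by rewrite (leq_trans _ Nn).
have n0 : (0 < n)%N by rewrite (leq_trans _ Nn).
have HL : L0 <= ln n%:R by apply: HN; clear -Nn; lia.
set L := ln n%:R in HL *.
have np : 0 < n%:R :> R by rewrite ltr0n.
have n2 : 2 <= n%:R :> R by rewrite ler_nat.
have l40 : 0 < 4 / ln D by rewrite divr_gt0.
have b70 : 0 < 7 / b ^+ 2 by rewrite divr_gt0 ?exprn_gt0.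
have L4 : 4 + 4 / ln D <= L by move: HL; rewrite /L0; lra.
have L7 : 7 / b ^+ 2 <= L by move: HL; rewrite /L0; lra.
have nL : L ^+ 2 / 2 <= n%:R.
  have -> : n%:R = expR L by rewrite lnK.
  by have := @expR_ge_sqr_half R L; lra.
have [l l0 [h1 h2]] := level_of_size n1.
have ln2 : (2 * l <= n)%N.
  apply: (half_levels l0 h1 h2 n0); rewrite -/L.
  have -> : 2 * (L / ln D + 1) = 1 / 2 * (L * (4 / ln D) + 4) by field; rewrite gt_eqF.
  have : L * (4 / ln D) <= L * (L - 4) by rewrite ler_wpM2l; lra.
  lra.
have [hl1 _] := level_bounds n0 h1 h2.
have [k kE [nk k1]] : exists2 k, n = (k + l)%N & (n <= 2 * k)%N /\ (0 < k)%N.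
  by clear -ln2 n0; exists (n - l)%N; lia.
pose X := b * n%:R - 7 / 2 * L / b.
have X0 : 0 <= X.
  rewrite subr_ge0 ler_pdivrMr//.
  have : L * 7 <= L * (L * b ^+ 2).
    by rewrite ler_wpM2l//; [lra|rewrite -ler_pdivrMr ?exprn_gt0].
  have : b ^+ 2 * (L ^+ 2 / 2) <= b ^+ 2 * n%:R by rewrite ler_wpM2l ?sqr_ge0.
  lra.
have Xn : X <= b * n%:R by rewrite /X lerBlDr lerDl divr_ge0 ?mulr_ge0 ?(ltW b0)//; lra.
pose H := X + C1.
have FH : expR (- 1) <= F k H.
  apply: (@le_trans _ _ (1 / 2)).
    by rewrite expRN mul1r lef_pV2 ?posrE ?expR_gt0//; have := expR_ge1Dx (1 : R); lra.
  apply: (le_trans (HC0 k k1)); apply: Fr_homo.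
  apply: (mean_max_levels C0 kE n0 nk); rewrite bb; lra.
pose T := D ^+ l.
have nT : n%:R <= T by rewrite /T -natrX ler_nat.
have Tn : T <= D * n%:R by rewrite /T -natrX -natrM ler_nat ltnW.
(* The shifts [e * D ^+ i], [i < l], then add up to [H], so the lift starts from 0 at the root. *)
pose e := H * (D - 1) / (T - 1).
have H0 : 0 <= H by rewrite addr_ge0.
have e0 : 0 <= e by rewrite divr_ge0 ?mulr_ge0//; lra.
have ec : e <= c.
  apply: le_trans Ec; rewrite /e ler_pdivrMr; last lra.
  have hT : n%:R <= 2 * (T - 1) by lra.
  have HHn : H <= (b + C1) * n%:R.
    have : C1 * 1 <= C1 * n%:R by rewrite ler_wpM2l//; lra.
    by rewrite /H; lra.
  have : H * (D - 1) <= (b + C1) * n%:R * (D - 1) by rewrite ler_wpM2r//; lra.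
  have : (b + C1) * (D - 1) * n%:R <= (b + C1) * (D - 1) * (2 * (T - 1)).
    by rewrite ler_wpM2l// mulr_ge0//; lra.
  rewrite /E; lra.
have := @Fr_lift k H e c l e0 c0 ec gc FH.
rewrite -kE -/T.
have -> : H - e * ((T - 1) / (D - 1)) = 0 by rewrite /e; field; rewrite !gt_eqF//; lra.
apply: le_trans; rewrite ler_expR lerN2 -/A -/X.
have -> : e ^+ 2 * T * (T - 1) / (2 * (D - 1)) = H ^+ 2 * (D - 1) * T / (2 * (T - 1)).
  by rewrite /e; field; rewrite !gt_eqF//; lra.
have := @lift_cost_le X H C1 T n%:R X0 C10 erefl Xn n2 nT.
have : T * A <= D * n%:R * A by rewrite ler_wpM2r.
have : 0 <= 2 * ln D * l%:R + (4 * c + 2 * ln D).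
  by rewrite addr_ge0 ?mulr_ge0 ?addr_ge0 ?mulr_ge0 ?(ltW lD).
rewrite /C; lra.
Qed.

End wall_prob.

(** * The tilted wall and the conditional mean *)

Section tilted_wall.
Context {R : realType}.
Variable d : nat.
Hypothesis hd : (2 <= d)%N.
Local Notation b := (@speed R d).
Local Notation F := (@Fr R d).
Local Notation D := (d%:R : R).

Lemma measurable_expR_affine (a u : R) : measurable_fun [set: R] (fun y => (expR (a + u * y))%:E).
Proof.
apply/measurable_EFinP; apply: measurableT_comp => //.
by apply: measurable_funD => //; exact: measurable_funM.
Qed.

Lemma tree_fun_exp_le m (a u x : R) :
  (tree_fun d m (fun y => (expR (a + u * y))%:E) x <=
   (expR (a * D ^+ m + (u * D ^+ m) ^+ 2 / (2 * (D - 1)) + u * D ^+ m * x))%:E)%E.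
Proof.
have D2 := @branching_ge2 R d hd.
rewrite tree_fun_exp// lee_fin ler_expR lerD2r lerD2l ler_pM2r ?invr_gt0; last by lra.
have Dm : 0 <= D ^+ m by rewrite exprn_ge0.
by rewrite exprMn -mulrA ler_wpM2l ?sqr_ge0//; nra.
Qed.

(** Chernoff bound for the average of the leaves rather than for one leaf: its variance is at most
    [1 / (D - 1)], whatever [m]. *)
Lemma Fr_exp_le m (u x : R) : 0 <= u -> F m x <= expR (u ^+ 2 / 2 + u * x).
Proof.
move=> u0; have D2 := @branching_ge2 R d hd.
have Dm : 0 < D ^+ m by rewrite exprn_gt0//; lra.
rewrite -lee_fin -tree_fun_wall.
have -> : u = u / D ^+ m * D ^+ m by rewrite divfK// gt_eqF.
set v := u / D ^+ m.
have v0 : 0 <= v by rewrite divr_ge0// ltW.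
apply: (@le_trans _ _ (tree_fun d m (fun y => (expR (0 + v * y))%:E) x)).
  apply: tree_fun_le; [exact: measurable_wall|exact: measurable_expR_affine|exact: wall_ge0|].
  move=> y; rewrite lee_fin add0r; case: (leP 0 y) => y0; last exact: expR_ge0.
  by apply: one_le_expR; rewrite mulr_ge0.
apply: (le_trans (tree_fun_exp_le _ _ _ _)).
rewrite lee_fin ler_expR mul0r add0r lerD2r.
apply: ler_wpM2l; first exact: sqr_ge0.
by rewrite lef_pV2 ?posrE//; lra.
Qed.

Lemma wall_tilt_le_wall (t y : R) : 0 <= t -> (wall_tilt (- t) y <= wall y)%E.
Proof.
move=> t0; rewrite lee_fin; case: (leP 0 y) => y0; last by rewrite mul0r.
by rewrite mul1r expR_le1 mulNr oppr_le0 mulr_ge0.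
Qed.

Lemma wall_tilt_le_exp (t y : R) : (wall_tilt t y <= (expR (0 + t * y))%:E)%E.
Proof.
rewrite lee_fin add0r; case: (0 <= y); first by rewrite mul1r.
by rewrite mul0r expR_ge0.
Qed.

(* [y0] is a level that the subtrees of height [k] stay below with small probability. *)
Lemma tilted_subtree_le k (t y0 L mu th eta x : R) : 0 <= t -> 0 <= mu -> 0 <= th ->
  F k y0 <= expR (- (2 * L)) -> th = t * D ^+ k + mu -> th * y0 + mu ^+ 2 <= L ->
  0 <= eta -> (t * D ^+ k) ^+ 2 / 2 <= eta ->
  (tree_fun d k (wall_tilt (- t)) x <= (expR (- (th * y0) + eta + mu * x))%:E)%E.
Proof.
move=> t0 mu0 th0 HF thE HL eta0 Heta; have D2 := @branching_ge2 R d hd.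
(* Above [y0] the wall is dropped and only the tilt kept; below [y0] the tilt is dropped and the
   wall kept. *)
have [xy|xy] := leP y0 x.
  apply: (@le_trans _ _ (tree_fun d k (fun y => (expR (0 + - t * y))%:E) x)).
    apply: tree_fun_le; [exact: measurable_wall_tilt|exact: measurable_expR_affine|exact: wall_tilt_ge0|].
    exact: wall_tilt_le_exp.
  apply: (le_trans (tree_fun_exp_le _ _ _ _)).
  rewrite lee_fin ler_expR mul0r add0r !mulNr sqrrN.
  have : (t * D ^+ k) ^+ 2 / (2 * (D - 1)) <= (t * D ^+ k) ^+ 2 / 2.
    by apply: ler_wpM2l; [exact: sqr_ge0|rewrite lef_pV2 ?posrE//; lra].
  have : 0 <= th * (x - y0) by rewrite mulr_ge0//; lra.
  rewrite thE; lra.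
apply: (@le_trans _ _ (F k x)%:E).
  rewrite -tree_fun_wall; apply: tree_fun_le.
  - exact: measurable_wall_tilt.
  - exact: measurable_wall.
  - exact: wall_tilt_ge0.
  - by move=> y; exact: wall_tilt_le_wall.
rewrite lee_fin; apply: (@le_trans _ _ (expR (- L + mu ^+ 2 + mu * x))); last first.
  by rewrite ler_expR; lra.
rewrite -ler_sqr ?nnegrE ?Fr_ge0 ?expR_ge0// expr2.
have h1 : F k x <= expR (- (2 * L)).
  by apply: le_trans HF; apply: Fr_homo; exact: ltW.
have h2 := @Fr_exp_le k (2 * mu) x; rewrite mulr_ge0// in h2.
apply: (@le_trans _ _ (expR (- (2 * L)) * expR ((2 * mu) ^+ 2 / 2 + 2 * mu * x))).
  by apply: ler_pM => //; [exact: Fr_ge0|exact: Fr_ge0|exact: h2].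
rewrite -expRD -expRM_natl ler_expR.
by rewrite le_eqVlt; apply/orP; left; apply/eqP; field.
Qed.

Lemma tilted_wall_le (K : R) : 0 < K -> exists C : R, exists N : nat, forall n : nat, (N <= n)%N ->
  (tree_fun d n (wall_tilt (- (K * n%:R / D ^+ n))) 0 <=
   (expR (- (K * n%:R * (b * n%:R - 37 / 5 * ln n%:R / b)) -
      (D - 1) / 2 * (b * n%:R - 37 / 5 * ln n%:R / b) ^+ 2 + C * n%:R))%:E)%E.
Proof.
move=> K0.
have b0 := @speed_gt0 R d hd; have D2 := @branching_ge2 R d hd.
have lD := @ln_branching_gt0 R d hd; have bb := @speed_sqr R d hd.
have [N1 HN1] := @Fr_lower_tail R d hd.
pose Db := (D - 1) * b.
have Db0 : 0 <= Db by rewrite mulr_ge0 ?(ltW b0)//; lra.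
pose Th := (K + Db) * b + Db ^+ 2.
have Th0 : 0 <= Th by rewrite addr_ge0 ?sqr_ge0// mulr_ge0 ?(ltW b0)//; lra.
pose L0 := 4 + 8 / ln D + 15 / b ^+ 2 + Th.
have [N2 HN2] := @ln_nat_ge R L0.
exists (K ^+ 2 * D), (N1 + N2).+2 => n Nn.
have [n1 n0 NN1 NN2] : [/\ (1 < n)%N, (0 < n)%N, (N1 <= n)%N & (N2 <= n)%N].
  by clear -Nn; split; lia.
have HL : L0 <= ln n%:R by exact: HN2.
have := HN1 n ^~ NN1; move: HL; set L := ln n%:R => HL HF.
have np : 0 < n%:R :> R by rewrite ltr0n.
have n2 : 2 <= n%:R :> R by rewrite ler_nat.
have l80 : 0 < 8 / ln D by rewrite divr_gt0.
have b15 : 0 < 15 / b ^+ 2 by rewrite divr_gt0 ?exprn_gt0.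
have L4 : 4 + 8 / ln D <= L by move: HL; rewrite /L0; lra.
have L7 : 15 / b ^+ 2 <= L by move: HL; rewrite /L0; lra.
have LT : Th <= L by move: HL; rewrite /L0; lra.
have nL : L ^+ 2 / 2 <= n%:R.
  have -> : n%:R = expR L by rewrite lnK.
  by have := @expR_ge_sqr_half R L; lra.
(* With about [n ^ 2] subtrees each carries a tilt [th] of order [1 / n], so that [th * y0] is
   bounded and hence below [L]. *)
have m1 : (1 < n ^ 2)%N by rewrite (leq_trans n1)// -{1}(expn1 n) leq_exp2l.
have m0 : (0 < n ^ 2)%N by rewrite expn_gt0 n0.
have [l l0 [h1 h2]] := level_of_size hd m1.
have lnm : ln (n ^ 2)%:R = 2 * L :> R by rewrite natrX lnXn// mulr_natl.
have ln2 : (2 * l <= n)%N.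
  apply: (@half_levels R d hd _ _ _ l0 h1 h2 m0); rewrite lnm.
  have -> : 2 * (2 * L / ln D + 1) = 1 / 2 * (L * (8 / ln D) + 4) by field; rewrite gt_eqF.
  have : L * (8 / ln D) <= L * (L - 4) by rewrite ler_wpM2l; lra.
  lra.
have [_ hl2] := @level_bounds R d hd _ _ m0 h1 h2.
have [k kE [nk k1 kn]] : exists2 k, n = (l + k)%N & [/\ (n <= 2 * k)%N, (0 < k)%N & (k <= n)%N].
  by clear -ln2 n0; exists (n - l)%N; [lia|split; lia].
set y0 := b * n%:R - 37 / 5 * L / b.
have y00 : 0 <= y0.
  rewrite subr_ge0 ler_pdivrMr//.
  have : L * 15 <= L * (L * b ^+ 2).
    by rewrite ler_wpM2l//; [lra|rewrite -ler_pdivrMr ?exprn_gt0].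
  have : b ^+ 2 * (L ^+ 2 / 2) <= b ^+ 2 * n%:R by rewrite ler_wpM2l ?sqr_ge0.
  lra.
have y0n : y0 <= b * n%:R by rewrite /y0 lerBlDr lerDl divr_ge0 ?mulr_ge0 ?(ltW b0)//; lra.
pose T := D ^+ l.
have nT : n%:R ^+ 2 <= T by rewrite /T -!natrX ler_nat.
have Tn : T <= D * n%:R ^+ 2 by rewrite /T -!natrX -natrM ler_nat ltnW.
have T0 : 0 < T by rewrite /T exprn_gt0//; lra.
have Dn : D ^+ n = T * D ^+ k by rewrite kE exprD.
have Dk : 0 < D ^+ k by rewrite exprn_gt0//; lra.
pose t := K * n%:R / D ^+ n.
have tD : t * D ^+ k = K * n%:R / T by rewrite /t Dn; field; rewrite !gt_eqF.
(* Minimises [- (mu * T) * y0 + (mu * T) ^+ 2 / (2 * (D - 1))], with value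
   [- (D - 1) / 2 * y0 ^+ 2]. *)
pose mu := (D - 1) * y0 / T.
have y0k : F k y0 <= expR (- (2 * L)).
  apply: le_trans (HF k nk kn); apply: Fr_homo.
  (* These levels lose 4 units of [L / b]; with the 17/5 of the lower tail this makes 37/5. *)
  have hbl : b * l%:R <= 4 * L / b + b.
    have -> : 4 * L / b + b = (2 * L + ln D) * (2 / b).
      by rewrite (_ : ln D = b ^+ 2 / 2); [field; rewrite gt_eqF|rewrite bb; field].
    have -> : b * l%:R = l%:R * ln D * (2 / b).
      by rewrite (_ : ln D = b ^+ 2 / 2); [field; rewrite gt_eqF|rewrite bb; field].
    by rewrite ler_pM2r ?divr_gt0// -lnm.
  have bn : b * n%:R = b * l%:R + b * k%:R by rewrite kE natrD mulrDr.
  rewrite /y0 bn; lra.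
have t0 : 0 <= t by rewrite divr_ge0 ?mulr_ge0 ?(ltW K0)// exprn_ge0//; lra.
have mu0 : 0 <= mu by rewrite divr_ge0 ?mulr_ge0 ?(ltW T0)//; lra.
have muE : mu * T = (D - 1) * y0 by rewrite /mu divfK// gt_eqF.
have nV : n%:R / T <= n%:R^-1.
  by rewrite ler_pdivrMr// ler_pdivlMl// -expr2.
have nV1 : n%:R^-1 <= 1 :> R by rewrite invf_le1//; lra.
have nV0 : 0 < n%:R^-1 :> R by rewrite invr_gt0.
have tU : t * D ^+ k <= K * n%:R^-1 by rewrite tD -mulrA ler_pM2l.
have tL : 0 <= t * D ^+ k by rewrite mulr_ge0// ltW.
have muU : mu <= Db * n%:R^-1.
  apply: (@le_trans _ _ (Db * (n%:R / T))); last by rewrite ler_wpM2l.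
  rewrite /mu /Db !mulrA ler_pM2r ?invr_gt0// -mulrA ler_wpM2l//; lra.
pose th := t * D ^+ k + mu.
have th0 : 0 <= th by rewrite addr_ge0.
have thy : th * y0 + mu ^+ 2 <= L.
  apply: le_trans LT; rewrite /Th; apply: lerD.
    apply: (@le_trans _ _ ((K + Db) * n%:R^-1 * (b * n%:R))).
      by apply: ler_pM => //; rewrite mulrDl lerD.
    by rewrite le_eqVlt; apply/orP; left; apply/eqP; field; rewrite gt_eqF.
  rewrite lerXn2r ?nnegrE//; apply: (le_trans muU); rewrite ler_piMr//.
pose eta := K ^+ 2 * n%:R^-1.
have eta0 : 0 <= eta by rewrite mulr_ge0 ?sqr_ge0// ltW.
have Heta : (t * D ^+ k) ^+ 2 / 2 <= eta.
  have : (t * D ^+ k) ^+ 2 <= (K * n%:R^-1) ^+ 2 by rewrite lerXn2r ?nnegrE// mulr_ge0// ltW.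
  have : n%:R^-1 ^+ 2 <= n%:R^-1 :> R by rewrite expr2 ler_piMr// ltW.
  rewrite exprMn /eta => h3 h4.
  have : K ^+ 2 * n%:R^-1 ^+ 2 <= K ^+ 2 * n%:R^-1 by rewrite ler_wpM2l ?sqr_ge0.
  have := sqr_ge0 (t * D ^+ k).
  lra.
have sub x := @tilted_subtree_le k t y0 L mu th eta x t0 mu0 th0 y0k erefl thy eta0 Heta.
have ms := @tree_fun_measurable_ge0 R d k _ (measurable_wall_tilt (- t)) (wall_tilt_ge0 (- t)).
rewrite -/t {1}kE tree_fun_add.
apply: (@le_trans _ _ (tree_fun d l (fun x => (expR (- (th * y0) + eta + mu * x))%:E) 0)).
  by apply: tree_fun_le; [exact: ms.1|exact: measurable_expR_affine|exact: ms.2|exact: sub].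
apply: (le_trans (tree_fun_exp_le _ _ _ _)).
rewrite lee_fin ler_expR mulr0 addr0 -/T muE.
have -> : ((D - 1) * y0) ^+ 2 / (2 * (D - 1)) = (D - 1) / 2 * y0 ^+ 2.
  by field; rewrite gt_eqF//; lra.
have thT : th * T = K * n%:R + (D - 1) * y0.
  by rewrite /th mulrDl muE tD divfK// gt_eqF.
have -> : (- (th * y0) + eta) * T = - (th * T * y0) + eta * T by ring.
rewrite thT.
have : eta * T <= K ^+ 2 * D * n%:R.
  rewrite /eta; apply: (@le_trans _ _ (K ^+ 2 * n%:R^-1 * (D * n%:R ^+ 2))).
    by rewrite ler_wpM2l// mulr_ge0 ?sqr_ge0// ltW.
  by rewrite le_eqVlt; apply/orP; left; apply/eqP; field; rewrite gt_eqF.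
lra.
Qed.

End tilted_wall.

Section conditional_mean.
Context {R : realType}.
Variable d : nat.
Hypothesis hd : (2 <= d)%N.
Local Notation b := (@speed R d).
Local Notation F := (@Fr R d).
Local Notation D := (d%:R : R).
Context (disp : measure_display) (T : measurableType disp) (P : probability T R).
Variables (n : nat) (X : nat * nat -> {RV P >-> R}).
Hypothesis iid : iid_standard_gaussian (edges d n) X.

Let d0 : (0 < d)%N. Proof. exact: leq_trans hd. Qed.
Let wm := wall_mean R d n.

Lemma tilt_divK (l : R) : l / D ^+ n * (d ^ n)%:R = l.
Proof. by rewrite natrX divfK// expf_neq0// pnatr_eq0 -lt0n. Qed.

(** Dropping the wall bounds the exponential moment by [expR h]; with [c = h - ln p] the factor
    [expR (- c)] turns this into [p], which cancels. *)
Lemma wall_mean_div_ub (l : R) : 0 < l -> 0 < F n 0 ->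
  (wm / (F n 0)%:E <= (l / (2 * (D - 1)) - ln (F n 0) / l)%:E)%E.
Proof.
move=> l0 p0; have D2 := @branching_ge2 R d hd.
set p := F n 0 in p0 *.
pose h := l ^+ 2 / (2 * (D - 1)).
have h0 : 0 <= h by rewrite divr_ge0 ?sqr_ge0//; lra.
have lp : ln p <= 0 by rewrite ln_le0// Fr_le1.
have c0 : 0 <= h - ln p by lra.
have t0 : 0 <= l / D ^+ n by rewrite divr_ge0 ?(ltW l0)// exprn_ge0.
have := wall_mean_ub d0 iid t0 c0.
rewrite tilt_divK tree_fun_wall -/p -/wm.
set H := tree_fun _ _ _ _ => hub.
have HH : (H <= (expR h)%:E)%E.
  apply: (@le_trans _ _ (tree_fun d n (fun y => (expR (0 + l / D ^+ n * y))%:E) 0)).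
    apply: tree_fun_le; [exact: measurable_wall_tilt|exact: measurable_expR_affine|exact: wall_tilt_ge0|].
    exact: wall_tilt_le_exp.
  apply: (le_trans (tree_fun_exp_le hd _ _ _ _)).
  have Dn : l / D ^+ n * D ^+ n = l by rewrite divfK// expf_neq0// pnatr_eq0 -lt0n.
  by rewrite lee_fin ler_expR mul0r add0r mulr0 addr0 Dn.
have {}hub : (l%:E * wm + p%:E <= (p + (h - ln p) * p)%:E)%E.
  apply: (le_trans hub); rewrite [X in (_ <= X)%E]EFinD [X in (_ <= _ + X)%E]EFinM leeD2r//.
  apply: (@le_trans _ _ ((expR (- (h - ln p)))%:E * (expR h)%:E)%E).
    by rewrite lee_wpmul2l// lee_fin expR_ge0.
  by rewrite -EFinM lee_fin -expRD (_ : - (h - ln p) + h = ln p) ?lnK//; ring.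
have wm0 : (0 <= wm)%E by exact: (@wall_mean_ge0 _ _ _ P d n X d0 iid).
case: wm wm0 hub => [r|_|//]; last first.
  by rewrite gt0_muley ?lte_fin// addye// leye_eq.
rewrite lee_fin => r0; rewrite -EFinM -EFinD lee_fin => hr.
rewrite inver gt_eqF// -EFinM lee_fin ler_pdivrMr// mulrBl.
rewrite -(ler_pM2l l0).
have -> : l * (l / (2 * (D - 1)) * p - ln p / l * p) = (h - ln p) * p.
  by rewrite /h; field; rewrite !gt_eqF//; lra.
lra.
Qed.

(** With [c = ln p - g] the exponential term is at most [p] and cancels. If this [c] is negative,
    the claim follows from the positivity of the mean. *)
Lemma wall_mean_div_lb (l g : R) : 0 < l -> 0 < F n 0 ->
  (tree_fun d n (wall_tilt (- (l / D ^+ n))) 0 <= (expR g)%:E)%E ->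
  (((ln (F n 0) - g) / l)%:E <= wm / (F n 0)%:E)%E.
Proof.
move=> l0 p0 HG; set p := F n 0 in p0 *.
have t0 : 0 <= l / D ^+ n by rewrite divr_ge0 ?(ltW l0)// exprn_ge0.
have wm0 : (0 <= wm)%E by exact: (@wall_mean_ge0 _ _ _ P d n X d0 iid).
have pinv0 : (0 <= (p%:E)^-1)%E by rewrite inve_ge0 lee_fin ltW.
have [c0|c0] := leP 0 (ln p - g); last first.
  apply: (@le_trans _ _ 0%E); last by rewrite mule_ge0.
  by rewrite lee_fin ler_pdivrMr// mul0r ltW.
have := wall_mean_lb d0 iid t0 c0.
rewrite tilt_divK tree_fun_wall -/p -/wm => hlb.
have {}hlb : ((p + (ln p - g) * p)%:E <= p%:E + l%:E * wm)%E.
  rewrite EFinD EFinM; apply: (le_trans hlb); rewrite leeD2r//.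
  apply: (@le_trans _ _ ((expR (ln p - g))%:E * (expR g)%:E)%E).
    by rewrite lee_wpmul2l// lee_fin expR_ge0.
  by rewrite -EFinM lee_fin -expRD subrK lnK.
case: wm wm0 hlb => [r|_ _|//]; last first.
  by rewrite gt0_mulye ?leey// inver gt_eqF// lte_fin invr_gt0.
rewrite lee_fin => r0; rewrite -EFinM -EFinD lee_fin => hr.
rewrite inver gt_eqF// -EFinM lee_fin ler_pdivlMr// mulrAC ler_pdivrMr//.
lra.
Qed.

End conditional_mean.

(** * The two constants of the theorem *)

Lemma speed_sqrt (R : realType) (d : nat) : (2 <= d)%N ->
  Num.sqrt 2 / Num.sqrt (ln d%:R) = 2 / @speed R d.
Proof.
move=> hd; have lD := @ln_branching_gt0 R d hd.
have s2 : 0 < Num.sqrt 2 :> R by rewrite sqrtr_gt0.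
have sl : 0 < Num.sqrt (ln d%:R) :> R by rewrite sqrtr_gt0.
have e2 : Num.sqrt 2 * Num.sqrt 2 = 2 :> R by rewrite -expr2 sqr_sqrtr.
rewrite /speed sqrtrM// -[X in X / (_ * _)]e2.
by field; rewrite !gt_eqF.
Qed.

(** The parameter [(D - 1) * X] minimises [l / (2 * (D - 1)) + (D - 1) * X ^+ 2 / (2 * l)], with
    minimum [X]; the O(n) error is divided by a quantity of order [n]. *)
Lemma arith_upper (R : realType) (b D n L X C lp : R) : 0 < b -> 2 <= D -> 0 < n ->
  b / 2 * n <= X -> - lp <= (D - 1) / 2 * X ^+ 2 + C * n -> 0 <= C ->
  (D - 1) * X / (2 * (D - 1)) - lp / ((D - 1) * X) <= X + 2 * C / ((D - 1) * b).
Proof.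
move=> b0 D2 n0 Xn hp C0.
have X0 : 0 < X by apply: lt_le_trans Xn; rewrite !mulr_gt0.
have l0 : 0 < (D - 1) * X by rewrite mulr_gt0//; lra.
have -> : (D - 1) * X / (2 * (D - 1)) = X / 2 by field; rewrite gt_eqF//; lra.
have h1 : - lp / ((D - 1) * X) <= ((D - 1) / 2 * X ^+ 2 + C * n) / ((D - 1) * X).
  by rewrite ler_pM2r ?invr_gt0.
have h2 : ((D - 1) / 2 * X ^+ 2 + C * n) / ((D - 1) * X) = X / 2 + C / (D - 1) * (n / X).
  by field; rewrite !gt_eqF//; lra.
have h3 : n / X <= 2 / b.
  by rewrite ler_pdivrMr// mulrAC ler_pdivlMr//; lra.
have h4 : C / (D - 1) * (n / X) <= C / (D - 1) * (2 / b).
  by rewrite ler_wpM2l// divr_ge0//; lra.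
have h5 : C / (D - 1) * (2 / b) = 2 * C / ((D - 1) * b).
  by field; rewrite !gt_eqF//; lra.
by move: h1; rewrite mulNr; lra.
Qed.

(** Here [X - y] is 39/10 units of [L / b] and [X + y] at most [2 * (b * n)]. Dividing by a tilt
    with the factor 39 leaves exactly 1/10 of a unit, and 37/5 + 1/10 = 15/2. *)
Lemma arith_lower (R : realType) (b D n L X y C1 C2 lp g : R) : 0 < b -> 2 <= D -> 0 < n -> 0 <= L ->
  X = b * n - 7 / 2 * L / b -> y = b * n - 37 / 5 * L / b ->
  - lp <= (D - 1) / 2 * X ^+ 2 + C1 * n ->
  g = - (39 * (D - 1) * b * n * y) - (D - 1) / 2 * y ^+ 2 + C2 * n ->
  b * n - 15 / 2 * L / b - (C1 + C2) / (39 * (D - 1) * b) <= (lp - g) / (39 * (D - 1) * b * n).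
Proof.
move=> b0 D2 n0 L0 XE yE hp gE.
have K0 : 0 < 39 * (D - 1) * b by rewrite !mulr_gt0//; lra.
set K := 39 * (D - 1) * b in K0 gE *.
rewrite ler_pdivlMr; last by rewrite mulr_gt0.
have Xy : X - y = 39 / 10 * (L / b) by rewrite XE yE; field; rewrite gt_eqF.
have Lb : 0 <= L / b by rewrite divr_ge0// ltW.
have sXy : X + y <= 2 * (b * n) by rewrite XE yE; lra.
have hXy : X ^+ 2 - y ^+ 2 <= 39 / 10 * (L / b) * (2 * (b * n)).
  have -> : X ^+ 2 - y ^+ 2 = 39 / 10 * (L / b) * (X + y) by rewrite -Xy; ring.
  by rewrite ler_wpM2l// mulr_ge0.
have hD : (D - 1) / 2 * (X ^+ 2 - y ^+ 2) <= (D - 1) / 2 * (39 / 10 * (L / b) * (2 * (b * n))).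
  by rewrite ler_wpM2l//; lra.
have e1 : (D - 1) / 2 * (39 / 10 * (L / b) * (2 * (b * n))) = K * n * (1 / 10 * (L / b)).
  by rewrite /K; field; rewrite gt_eqF.
have e2 : (b * n - 15 / 2 * L / b - (C1 + C2) / K) * (K * n) =
    K * n * y - K * n * (1 / 10 * (L / b)) - (C1 + C2) * n.
  by rewrite yE; field; rewrite !gt_eqF.
rewrite e1 in hD; rewrite e2 gE; lra.
Qed.

Theorem theorem1p2 (R : realType) (d : nat) (hd : (2 <= d)%N) :
  exists (C : R) (N : nat), forall n : nat, (N <= n)%N ->
  forall (disp : measure_display) (T : measurableType disp)
    (P : probability T R) (X : nat * nat -> {RV P >-> R}),
  iid_standard_gaussian (edges d n) X ->
  forall u : nat, leaves d n u ->
  ((mean_max R d n - 3 * Num.sqrt 2 / Num.sqrt (ln d%:R) * ln n%:R - C)%:E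
     <= cond_expectation P (brw d n X u)
          [set w | forall v, leaves d n v -> (0 <= brw d n X v w)%R]
     <= (mean_max R d n - Num.sqrt 2 / Num.sqrt (ln d%:R) * ln n%:R + C)%:E)%E.
Proof.
pose b := @speed R d.
have b0 := @speed_gt0 R d hd; have D2 := @branching_ge2 R d hd.
have K0 : 0 < 39 * (d%:R - 1) * b by rewrite !mulr_gt0//; lra.
have [C1 [N1 [C10 HN1]]] := @wall_prob_ge R d hd.
have [C2 [N2 HN2]] := @tilted_wall_le R d hd _ K0.
have [N3 HN3] := @ln_nat_ge R (7 / b ^+ 2 + 7 / b ^+ 2 + 1).
pose Cu := 2 * C1 / ((d%:R - 1) * b).
pose Cl := (C1 + C2) / (39 * (d%:R - 1) * b).
exists (`|Cu| + `|Cl|), (N1 + N2 + N3).+1 => n Nn disp T P X iid u un.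
have [n0 n1 n2 n3] : [/\ (0 < n)%N, (N1 <= n)%N, (N2 <= n)%N & (N3 <= n)%N].
  by clear -Nn; split; lia.
have np : 0 < n%:R :> R by rewrite ltr0n.
have d0 : (0 < d)%N by exact: leq_trans hd.
rewrite -/(wall_event d n X) (cond_expectation_wall d0 iid un) tree_fun_wall.
have := HN1 n n1; have := HN2 n n2; have := HN3 n n3.
set L := ln n%:R => HL HG Hp.
have p0 : 0 < Fr d n (0 : R) by apply: lt_le_trans Hp; exact: expR_gt0.
set Y := b * n%:R - 7 / 2 * L / b.
set y := b * n%:R - 37 / 5 * L / b.
have lpp : - ln (Fr d n (0 : R)) <= (d%:R - 1) / 2 * Y ^+ 2 + C1 * n%:R.
  by rewrite lerNl -(expRK (- _)) ler_ln ?posrE ?expR_gt0.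
have b2 : 0 < b ^+ 2 by rewrite exprn_gt0.
have b70 : 0 < 7 / b ^+ 2 by rewrite divr_gt0.
have L0 : 0 <= L by lra.
have Yn : b / 2 * n%:R <= Y.
  have nL : L ^+ 2 / 2 <= n%:R.
    have -> : n%:R = expR L by rewrite lnK.
    by have := @expR_ge_sqr_half R L L0; lra.
  have h1 : L * 14 <= L * (L * b ^+ 2).
    rewrite ler_wpM2l// -ler_pdivrMr//.
    by rewrite (_ : 14 / b ^+ 2 = 7 / b ^+ 2 + 7 / b ^+ 2); [lra|field; rewrite gt_eqF].
  have h2 : b ^+ 2 * (L ^+ 2 / 2) <= b ^+ 2 * n%:R by rewrite ler_wpM2l// ltW.
  have h3 : 7 / 2 * L / b <= b / 2 * n%:R by rewrite ler_pdivrMr//; lra.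
  by rewrite /Y; lra.
have Y0 : 0 < Y by apply: lt_le_trans Yn; rewrite !mulr_gt0.
have s2 := @speed_sqrt R d hd.
(* In units of [L / b] the centring contributes 3/2, and the two corrections 6 and 2. *)
have e1 : mean_max R d n - 3 * Num.sqrt 2 / Num.sqrt (ln d%:R) * L = b * n%:R - 15 / 2 * L / b.
  by rewrite -(mulrA 3) s2 mean_maxE -/L -/b; field; rewrite gt_eqF.
have e2 : mean_max R d n - Num.sqrt 2 / Num.sqrt (ln d%:R) * L = Y.
  by rewrite s2 mean_maxE -/L -/b /Y; field; rewrite gt_eqF.
rewrite e1 e2; apply/andP; split.
- have l0 : 0 < 39 * (d%:R - 1) * b * n%:R by rewrite mulr_gt0.
  apply: le_trans (wall_mean_div_lb hd iid l0 p0 HG).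
  rewrite lee_fin.
  apply: le_trans (@arith_lower R b d%:R n%:R L Y y C1 C2 _ _ b0 D2 np L0 erefl erefl lpp erefl).
  by have := ler_norm Cl; have := normr_ge0 Cu; rewrite -/Cl; lra.
- have l0 : 0 < (d%:R - 1) * Y by rewrite mulr_gt0//; lra.
  apply: (le_trans (wall_mean_div_ub hd iid l0 p0)).
  rewrite lee_fin.
  apply: (le_trans (@arith_upper R b d%:R n%:R L Y C1 _ b0 D2 np Yn lpp C10)).
  by have := ler_norm Cu; have := normr_ge0 Cl; rewrite -/Cu; lra.
Qed.
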